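(* Let $d\in 2\mathbb{N}$ and $g\in\mathbb{Z}\setminus\{-1\}$ with $g\neq b^h$ for all $b,h\in\mathbb{Z}$, $h\geq 2$; write $g = g_0g_s^2$ with $g_0$ square-free, and let $\tilde g := |g_0|$ if $g_0$ is odd and $\tilde g := |g_0/2|$ if $g_0$ is even. Suppose $[d,g]$ is Artin admissible and assume hypothesis (H) below. Then for every $C>0$, $$\Pi_{d,g}(x) = 8\cdot\frac{C_{d,\tilde g}\,A_{d,g}}{|\varphi_d(\tilde g)|}\cdot\prod_{\substack{p\mid d\\ p>2}}\left(\frac{p-1}{p-2}\right) C_2\,\mathrm{Li}_2(x) + O\!\left(\frac{x}{(\log x)^C}\right),$$ where, writing $\Omega(\varepsilon_1,\varepsilon_2)$ for $\Omega_{d,g}(\varepsilon_1,\varepsilon_2)$: if $g_0$ is odd, $A_{d,g} := \Omega(-1,-1)$ if $g_0\equiv 1\pmod 4$; $A_{d,g} := \frac12(\Omega(-1,-1)+\Omega(1,1))$ if $g_0\equiv 3\pmod 4$ and $d\equiv 0\pmod 4$; $A_{d,g} := \frac12(\Omega(-1,1)+\Omega(1,-1))$ if $g_0\equiv 3\pmod 4$ and $d\equiv 2 \pmod 4$; and if $g_0$ is even, $A_{d,g} := \frac12(\Omega(-1,-1)+\Omega(1,1))$ if $d\equiv 0\pmod 8$; $A_{d,g} := \frac12(\Omega(-1,1)+\Omega(1,-1))$ if $d\equiv 4\pmod 8$; $A_{d,g} := \frac14(\Omega(-1,1)+\Omega(1,1)+\Omega(1,-1)+\Omega(-1,-1))$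 if $d\equiv 2,6\pmod 8$.
   Context: $\left(\frac{a}{n}\right)$ is the Jacobi symbol for odd positive $n$ (with $\left(\frac a1\right)=1$); $\varphi$ is Euler's totient; products over $p$ are over primes. For odd $n\in\mathbb{N}$, $\Delta_{d,g}(n) := 1$ if $\left(\frac gn\right) = \left(\frac{g}{n+d}\right) = -1$ and $0$ otherwise; $[d,g]$ is Artin admissible if $\Delta_{d,g}(n)=1$ for infinitely many odd $n$. $\pi_d(x)$ is the set of primes $p$ with $p,p+d$ both odd primes and $p,p+d\leq x$, and $\Pi_{d,g}(x) := \sum_{p\in\pi_d(x)} 4\frac{\varphi(p-1)}{p-1}\frac{\varphi(p+d-1)}{p+d-1}\Delta_{d,g}(p)$. For $m \in\mathbb{N}$, $\varphi_d(m) := \{1\leq\alpha\leq m : (\alpha,m)=(\alpha+d,m)=1\}$. $C_2 := \prod_{p>2}(1-(p-1)^{-2})$, $\mathrm{Li}_2(x) := \int_2^x(\log t)^{-2}dt$. $C_{d,f} := \prod_{p\mid d,\ p\nmid f}\left(1+\frac{1}{p^2(p-1)}-\frac{2}{p(p-1)}\right)\prod_{p\mid d+1\text{ or }p\mid d-1,\ p\nmid f}\left(1-\frac1{p(p-2)}\right)\prod_{p\nmid d(d+1)(d-1),\ p\nmid f}\left(1-\frac{2}{p(p-2)}\right)$. $K_{d,f}(a) := \prod_{p\mid d,\ p\mid(a-1,f)}\left(1+\frac1{p^2}-\frac2p\right)\prod_{p\nmid d,\ p\mid (a-1,f)}\left(1-\frac1p\right)\prod_{p\nmid d,\ p\mid(a+d-1,f)}\left(1-\frac1p\right)$.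 $\Phi_{\varepsilon_1,\varepsilon_2}(\tilde g,d) := \{1\leq\alpha\leq\tilde g : \left(\frac{\alpha}{\tilde g}\right)=\varepsilon_1,\ \left(\frac{\alpha+d}{\tilde g}\right)=\varepsilon_2\}$ and $\Omega_{d,g}(\varepsilon_1,\varepsilon_2) := \sum_{a\in\Phi_{\varepsilon_1,\varepsilon_2}(\tilde g,d)}K_{d,\tilde g}(a)$ for $\varepsilon_1,\varepsilon_2\in\{-1,1\}$. For $a,q\in\mathbb{N}$, $\pi_d(x;a,q)$ is the number of $p\in\pi_d(x)$ with $p\equiv a\pmod q$. Hypothesis (H): for all $B',C'\geq 0$ there is a constant $K$ (depending on $B',C',d$) such that for all sufficiently large $x$ and all $a,q\in\mathbb{N}$ with $q\leq(\log x)^{B'}$ and $(a,q)=(a+d,q)=1$, $\left|\pi_d(x;a,q) - \frac{2}{|\varphi_d(q)|}\prod_{p\mid d,\,p>2}\frac{p-1}{p-2}\,C_2\,\mathrm{Li}_2(x)\right|\leq K\frac{x}{(\log x)^{C'}}$. *)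

(* Defs.v *)
From HB Require Import structures.
From mathcomp Require Import all_boot all_order all_algebra.
From mathcomp Require Import all_classical all_reals all_analysis.

Set Implicit Arguments.
Unset Strict Implicit.
Unset Printing Implicit Defensive.

Import Order.TTheory GRing.Theory Num.Theory.
Import numFieldNormedType.Exports.

Local Open Scope classical_set_scope.
Local Open Scope ring_scope.

(* Only used at odd primes p. *)
Definition legendre (a : int) (p : nat) : int :=
  if (p %| a)%Z then 0
  else if [exists x : 'I_p, ((x%:Z ^+ 2)%R == a %[mod p])%Z] then 1
  else -1.

(* Only used at odd positive n. *)
Definition jacobi (a : int) (n : nat) : int :=
  \prod_(p <- primes n) legendre a p ^+ logn p n.

Definition squarefree (m : int) : Prop :=
  forall k : int, (k ^+ 2 %| m)%Z -> k \is a GRing.unit.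

Definition Delta (d : nat) (g : int) (n : nat) : nat :=
  (jacobi g n == -1) && (jacobi g (n + d) == -1).

Definition artin_admissible (d : nat) (g : int) : Prop :=
  infinite_set [set n : nat | odd n /\ Delta d g n = 1%N].

Definition gtilde (g0 : int) : nat :=
  if odd `|g0|%N then `|g0|%N else `|(g0 %/ 2)%Z|%N.

Definition phiset (d m : nat) : seq nat :=
  [seq a <- iota 1 m | coprime a m && coprime (a + d) m].

Definition Phiset (e1 e2 : int) (gt d : nat) : seq nat :=
  [seq a <- iota 1 gt | (jacobi a%:Z gt == e1) && (jacobi (a + d)%:Z gt == e2)].

Section RealQuantities.
Variable R : realType.
Implicit Types (d f a q n : nat) (g : int) (x : R).

(* The bound truncn x only makes the enumeration finite; the membership
   conditions are the ones in the filter. *)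
Definition pi_set d x : seq nat :=
  [seq p <- iota 0 (Num.truncn x).+1 |
    [&& prime p, odd p, prime (p + d), odd (p + d),
        p%:R <= x & (p + d)%:R <= x]].

Definition pi_count d x a q : nat :=
  count (fun p => p == a %[mod q]) (pi_set d x).

Definition Pi d g x : R :=
  \sum_(p <- pi_set d x)
    4 * ((totient p.-1)%:R / p.-1%:R)
      * ((totient (p + d).-1)%:R / (p + d).-1%:R) * (Delta d g p)%:R.

(* Infinite product over the primes satisfying P, in increasing order. *)
Definition prime_prod (P : pred nat) (F : nat -> R) : R :=
  lim ((fun n => \prod_(0 <= p < n | prime p && P p) F p) @ \oo).

Definition C2 : R :=
  prime_prod (fun p => 2 < p)%N (fun p => 1 - (p%:R - 1) ^- 2).

(* For x < 2 the domain is empty and the value is 0; only large x matter. *)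
Definition Li2 x : R :=
  \int[lebesgue_measure]_(t in `[2, x]) ((ln t) ^- 2).

Definition local_factor d : R :=
  \prod_(p <- primes d | (2 < p)%N) ((p%:R - 1) / (p%:R - 2)).

Definition Cconst d f : R :=
  (\prod_(p <- primes d | ~~ (p %| f)%N)
      (1 + (p%:R ^+ 2 * (p%:R - 1))^-1 - 2 / (p%:R * (p%:R - 1))))
  * (\prod_(0 <= p < d.+2 |
        [&& prime p, (p %| d.+1)%N || (p %| d.-1)%N & ~~ (p %| f)%N])
      (1 - (p%:R * (p%:R - 2))^-1))
  * prime_prod (fun p => ~~ (p %| d * d.+1 * d.-1)%N && ~~ (p %| f)%N)
      (fun p => 1 - 2 / (p%:R * (p%:R - 2))).

Definition Kconst d f a : R :=
  (\prod_(p <- primes (gcdn a.-1 f) | (p %| d)%N)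
      (1 + (p%:R ^+ 2)^-1 - 2 / p%:R))
  * (\prod_(p <- primes (gcdn a.-1 f) | ~~ (p %| d)%N) (1 - p%:R^-1))
  * (\prod_(p <- primes (gcdn (a + d).-1 f) | ~~ (p %| d)%N) (1 - p%:R^-1)).

(* Omega and Aconst depend on g only through its square-free part g0. *)
Definition Omega d (g0 e1 e2 : int) : R :=
  \sum_(a <- Phiset e1 e2 (gtilde g0) d) Kconst d (gtilde g0) a.

(* For odd g0 the test g0 = 1 mod 4 fails exactly when g0 = 3 mod 4; for d even
   the last branch in each case is d = 2 mod 4. *)
Definition Aconst d (g0 : int) : R :=
  let W := Omega d g0 in
  if odd `|g0|%N then
    if (g0 == 1 %[mod 4])%Z then W (-1) (-1)
    else if (d == 0 %[mod 4])%N then 2^-1 * (W (-1) (-1) + W 1 1)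
    else 2^-1 * (W (-1) 1 + W 1 (-1))
  else
    if (d == 0 %[mod 8])%N then 2^-1 * (W (-1) (-1) + W 1 1)
    else if (d == 4 %[mod 8])%N then 2^-1 * (W (-1) 1 + W 1 (-1))
    else 4^-1 * (W (-1) 1 + W 1 1 + W 1 (-1) + W (-1) (-1)).

Definition hypothesis_H d : Prop :=
  forall B' C' : R, 0 <= B' -> 0 <= C' ->
  exists K : R, \forall x \near +oo,
    forall a q : nat, (0 < a)%N -> (0 < q)%N ->
      q%:R <= ln x `^ B' -> coprime a q -> coprime (a + d) q ->
      `| (pi_count d x a q)%:R
         - 2 / (size (phiset d q))%:R * local_factor d * C2 * Li2 x |
      <= K * (x / ln x `^ C').

End RealQuantities.

Arguments C2 {R}.
Arguments local_factor {R} d.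
Arguments Cconst {R} d f.
Arguments Kconst {R} d f a.
Arguments Omega {R} d g0 e1 e2.
Arguments Aconst {R} d g0.
Arguments hypothesis_H R d : clear implicits.

(* Main.v *)
(* Write phi(m)/m = sum_{k | m} mu(k)/k and truncate this sum at k <= y for
   m = p - 1 and at k <= y^4 for m = p + d - 1, with y a power of log x.
   Discarding the large k costs O(x/y), because an integer k > y divides at most
   x/k of the integers up to x. By quadratic reciprocity Delta(p) depends only
   on p modulo 8 * gtilde, so each remaining term counts the prime pairs in
   residue classes modulo q = 8 * gtilde * k1 * k2 <= (log x)^B, which (H)
   evaluates. The resulting main term is an average over the admissible residue
   classes; such averages do not depend on the modulus and are multiplicative by
   the Chinese remainder theorem. Since phi_d(k) >= sqrt (k / 6), the truncation
   can be undone inside the average at cost O(1/sqrt y), leaving an Euler product: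
   the conditions modulo 8 and modulo gtilde give A, the other odd primes and
   the constant factor 1/4 at 2 give C_{d,gtilde}. *)

Require Import Defs.
From HB Require Import structures.
From mathcomp Require Import all_boot all_order all_algebra.
From mathcomp Require Import all_fingroup all_solvable all_field.
From mathcomp Require Import all_classical all_reals all_analysis.
From mathcomp Require Import zify ring lra.
Set Implicit Arguments.
Unset Strict Implicit.
Unset Printing Implicit Defensive.

Import Order.TTheory GRing.Theory Num.Theory.
Import numFieldNormedType.Exports.
Local Open Scope classical_set_scope.
Local Open Scope ring_scope.

(** * Quadratic reciprocity *)

(** The second cut-off is y^4 because the two truncation errors are not symmetric. In a b - a' b' =
    (a - a') b + a' (b - b') the error of the second factor is multiplied by the first truncated
    sum, which is bounded only by y. Inside the average this costs 1/sqrt y + y/sqrt z up to a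
    constant, and z = y^4 turns the second term into 1/y. The infinite Euler product is never
    averaged. For fixed y and z the truncated average is compared with the finite product over the
    primes up to Z, with a bound independent of Z; then Z tends to infinity. So every average is a
    finite sum over the residues of one modulus. The bound sqrt (k/6) is far below the true size of
    phi_d(k), but it can be checked one prime at a time, and it is enough because the sum of
    k^(-3/2) converges. The factor 8 in the result is the weight 4 in [Pi] times the 2 in (H).
    Reciprocity is derived in a finite field of characteristic p that contains r-th roots of unity:
    there Frobenius computes the p-th power of a Gauss sum. *)

Lemma finField_prim_root (F : finFieldType) :
  exists z : F, (#|F|.-1).-primitive_root z.
Proof.
have F_gt1 : (1 < #|F|)%N by apply: finNzRing_gt1.
have := @has_prim_root F #|F|.-1 [seq x <- enum F | x != 0].
case/(_ _ _ _ _)/hasP => [||||z _ zP]; last by exists z.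
- by rewrite -ltnS prednK // ltnW.
- apply/allP => x; rewrite mem_filter => /andP[x_neq0 _].
  rewrite unity_rootE; apply/eqP/(mulfI x_neq0).
  by rewrite -exprS prednK ?expf_card ?mulr1 // ltnW.
- exact/filter_uniq/enum_uniq.
- rewrite -(@leq_add2l 1) add1n prednK; last exact: ltnW.
  rewrite cardE -(count_predC (pred1 (0 : F)) (enum F)) size_filter.
  by rewrite leq_add ?count_uniq_mem ?enum_uniq ?leq_b1.
Qed.

(** By Euler's theorem n divides p ^ totient n - 1, the order of the multiplicative group of the
    field with p ^ totient n elements. The Gauss sums live in this field. *)
Lemma prim_root_in_char (p n : nat) : prime p -> (0 < n)%N -> coprime p n ->
  exists (F : finFieldType), p \in [pchar F] /\ exists z : F, n.-primitive_root z.
Proof.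
move=> p_pr n_gt0 p_n.
have t_gt0 : (0 < totient n)%N by rewrite totient_gt0.
have [F charF cardF] := pPrimePowerField p_pr t_gt0.
exists F; split => //; have [z zP] := finField_prim_root F.
exists (z ^+ (#|F|.-1 %/ n)); apply: dvdn_prim_root => //.
rewrite cardF -subn1 -eqn_mod_dvd ?expn_gt0 ?prime_gt0 //.
exact/eqP/Euler_exp_totient.
Qed.

Lemma legendreE (a : int) (p : nat) : prime p ->
  legendre a p = if a%:~R == 0 :> 'F_p then 0
                 else if [exists x : 'F_p, x ^+ 2 == a%:~R] then 1 else -1.
Proof.
move=> p_pr; rewrite /legendre (dvdz_pcharf (pchar_Fp p_pr)).
case: (_ == 0) => //; congr (if _ then _ else _); apply/existsP/existsP => -[x].
  rewrite eqz_mod_dvd (dvdz_pcharf (pchar_Fp p_pr)) rmorphB /= subr_eq0 => xP.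
  by exists (x%:Z%:~R : 'F_p); rewrite -rmorphXn.
move=> xP; have x_lt : (x < p)%N by rewrite -[X in (_ < X)%N](Fp_cast p_pr).
exists (Ordinal x_lt); rewrite eqz_mod_dvd (dvdz_pcharf (pchar_Fp p_pr)).
by rewrite [(_ - _)%:~R]rmorphB rmorphXn /= subr_eq0 -pmulrn natr_Zp.
Qed.

Lemma odd_prime_half (p : nat) : prime p -> odd p -> (p.-1./2 * 2)%N = p.-1.
Proof.
move=> p_pr p_odd; rewrite muln2 -[RHS]odd_double_half.
by rewrite -subn1 oddB ?prime_gt0 // p_odd.
Qed.

Lemma euler_criterion (p : nat) (x : 'F_p) : prime p -> odd p ->
  x ^+ p.-1./2 = if x == 0 then 0 else
                 if [exists y : 'F_p, y ^+ 2 == x] then 1 else -1.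
Proof.
move=> p_pr p_odd; have p_gt2 : (2 < p)%N by apply: odd_prime_gt2.
have halfE := odd_prime_half p_pr p_odd.
case: eqP => [->|/eqP x_neq0].
  rewrite expr0n; suff: (0 < p.-1./2)%N by case: (_./2).
  by rewrite half_gt0; case: (p) p_gt2 => [|[|[]]].
have fermat (y : 'F_p) : y != 0 -> y ^+ p.-1 = 1.
  move=> y_neq0; apply/(mulfI y_neq0); rewrite -exprS prednK ?prime_gt0 //.
  by rewrite -[X in y ^+ X](card_Fp p_pr) expf_card mulr1.
case: existsP => [[y /eqP yx]|no_sq].
  rewrite -yx -exprM mulnC halfE fermat //.
  by apply: contraNneq x_neq0 => y0; rewrite -yx y0 expr0n.
have /eqP : (x ^+ p.-1./2) ^+ 2 = 1 by rewrite -exprM halfE fermat.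
(* If the power is 1, write x = z ^ i with z a primitive root. The order p - 1 of z divides i (p -
   1)/2, so i is even and x is a square after all. *)
rewrite sqrf_eq1 => /orP[/eqP xh|/eqP //]; case: no_sq.
have [z zP] := finField_prim_root 'F_p; rewrite card_Fp // in zP.
have [i xi] := prim_rootP zP (fermat _ x_neq0).
have : (2 %| i)%N.
  have : (0 < p.-1./2)%N by rewrite half_gt0; case: (p) p_gt2 => [|[|[]]].
  move/dvdn_pmul2r => <-; rewrite [(2 * _)%N]mulnC halfE.
  by rewrite (prim_order_dvd zP) exprM -xi xh.
case/dvdnP=> j ij; exists (z ^+ j); by rewrite -exprM -ij xi.
Qed.

(** Euler's criterion is needed in an extension of ['F_p], where the Gauss sums live. The transfer
    goes through divisibility of an integer by [p]. *)
Lemma legendre_pow (F : nzRingType) (a : int) (p : nat) : prime p -> odd p ->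
  p \in [pchar F] -> (a%:~R : F) ^+ p.-1./2 = (legendre a p)%:~R.
Proof.
move=> p_pr p_odd charF; apply/eqP; rewrite -rmorphXn -subr_eq0 -rmorphB /=.
rewrite -(dvdz_pcharf charF) (dvdz_pcharf (pchar_Fp p_pr)) rmorphB rmorphXn /=.
rewrite subr_eq0 euler_criterion // legendreE //.
by case: (a%:~R == 0) => //; case: ifP.
Qed.

Lemma legendre_val (a : int) (p : nat) :
  [\/ legendre a p = 0, legendre a p = 1 | legendre a p = -1].
Proof.
rewrite /legendre; case: ifP => _; first by constructor 1.
by case: ifP => _; [constructor 2 | constructor 3].
Qed.

(** The two values differ by at most 2 < p. Identities between symbols can thus be proved in
    characteristic [p] and read back in the integers. *)
Lemma sign_inj_char (F : nzRingType) (p : nat) (a b : int) : (2 < p)%N ->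
  p \in [pchar F] -> [\/ a = 0, a = 1 | a = -1] -> [\/ b = 0, b = 1 | b = -1] ->
  a%:~R = b%:~R :> F -> a = b.
Proof.
move=> p_gt2 charF aP bP /eqP; rewrite -subr_eq0 -rmorphB -(dvdz_pcharf charF).
rewrite dvdzE => /= ab; apply/eqP; rewrite -subr_eq0 -absz_eq0.
apply: contraLR ab => ab; rewrite gtnNdvd ?lt0n //.
by apply: leq_ltn_trans p_gt2; case: aP => ->; case: bP => ->.
Qed.

Lemma legendreM (a b : int) (p : nat) : prime p -> odd p ->
  legendre (a * b) p = legendre a p * legendre b p.
Proof.
move=> p_pr p_odd; have p_gt2 : (2 < p)%N by apply: odd_prime_gt2.
apply: (sign_inj_char p_gt2 (pchar_Fp p_pr)); first exact: legendre_val.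
  case: (legendre_val a p) => ->; case: (legendre_val b p) => ->;
  by [constructor 1|constructor 2|constructor 3].
by rewrite rmorphM /= -!(legendre_pow _ p_pr p_odd (pchar_Fp p_pr)) rmorphM exprMn.
Qed.

Lemma legendre_eq0 (a : int) (p : nat) : (legendre a p == 0) = (p %| a)%Z.
Proof. by rewrite /legendre; case: ifP => // _; case: ifP. Qed.

Lemma legendre_sqr (a : int) (p : nat) : prime p -> odd p -> ~~ (p %| a)%Z ->
  legendre (a ^+ 2) p = 1.
Proof.
move=> p_pr p_odd; rewrite -legendre_eq0 expr2 legendreM //.
by case: (legendre_val a p) => ->.
Qed.

Lemma legendre1 (p : nat) : prime p -> odd p -> legendre 1 p = 1.
Proof.
move=> p_pr p_odd; rewrite -(expr1n _ 2) legendre_sqr // dvdzE /= dvdn1.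
by apply: contraTneq p_pr => ->.
Qed.

Lemma eq_legendre (a b : int) (p : nat) : (a = b %[mod p])%Z ->
  legendre a p = legendre b p.
Proof.
move=> ab; rewrite /legendre; have -> : (p %| a)%Z = (p %| b)%Z.
  by apply/dvdz_mod0P/dvdz_mod0P; rewrite ab.
by under eq_existsb => x do rewrite ab.
Qed.

Lemma legendreN1 (p : nat) : prime p -> odd p ->
  legendre (-1) p = if (p %% 4 == 1)%N then 1 else -1.
Proof.
move=> p_pr p_odd; have p_gt2 : (2 < p)%N by apply: odd_prime_gt2.
apply: (sign_inj_char p_gt2 (pchar_Fp p_pr)); first exact: legendre_val.
  by case: ifP; [constructor 2|constructor 3].
rewrite -(legendre_pow _ p_pr p_odd (pchar_Fp p_pr)) rmorphN rmorph1.
rewrite -signr_odd; have -> : odd p.-1./2 = (p %% 4 != 1)%N by lia.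
by case: (_ == _); rewrite /= ?expr0 ?expr1 ?rmorph1 ?rmorphN ?rmorph1.
Qed.

(** A primitive root works: its power of exponent (p - 1)/2 is not 1. *)
Lemma exists_nonresidue (p : nat) : prime p -> odd p ->
  exists a : nat, legendre a p = -1.
Proof.
move=> p_pr p_odd; have p_gt2 : (2 < p)%N by apply: odd_prime_gt2.
have halfE := odd_prime_half p_pr p_odd.
have [z zP] := finField_prim_root 'F_p; rewrite card_Fp // in zP.
have z_neq0 : z != 0 by rewrite (prim_root_eq0 zP); lia.
exists (z : nat); have := legendre_pow (z : nat)%:Z p_pr p_odd (pchar_Fp p_pr).
rewrite -pmulrn natr_Zp => zh.
have {zh} : legendre (z : nat) p != 1.
  apply: contraTneq isT => leg1; move: zh; rewrite leg1 rmorph1 => /eqP.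
  by rewrite -(prim_order_dvd zP) gtnNdvd //; lia.
case: (legendre_val (z : nat)%:Z p) => [/eqP|->|] //.
by rewrite legendre_eq0 (dvdz_pcharf (pchar_Fp p_pr)) -pmulrn natr_Zp (negPf z_neq0).
Qed.

(** * The quadratic Gauss sum modulo r in characteristic p *)

Section GaussSum.

Variables (p r : nat) (F : finFieldType) (z : F).
Hypotheses (p_pr : prime p) (p_odd : odd p) (r_pr : prime r) (r_odd : odd r).
Hypotheses (p_neq_r : p != r) (charF : p \in [pchar F]).
Hypothesis (zP : r.-primitive_root z).

Let chi (x : 'F_r) : F := (legendre (x : nat)%:Z r)%:~R.
Let e (x : 'F_r) : F := z ^+ x.

Let chiM (x y : 'F_r) : chi (x * y) = chi x * chi y.
Proof.
have -> : x * y = ((x : nat) * (y : nat))%:R by rewrite natrM !natr_Zp.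
rewrite /chi -rmorphM -legendreM // val_Fp_nat //; congr (_%:~R).
by apply: eq_legendre; rewrite -modz_nat modz_mod PoszM.
Qed.

Let chi_int (a : int) (x : 'F_r) : a%:~R = x -> chi x = (legendre a r)%:~R.
Proof.
move=> ax; rewrite /chi; congr (_%:~R); apply: eq_legendre; apply/eqP.
rewrite eqz_mod_dvd (dvdz_pcharf (pchar_Fp r_pr)) rmorphB /= subr_eq0.
by rewrite -pmulrn natr_Zp ax.
Qed.

Let chi0 : chi 0 = 0.
Proof. by rewrite /chi /= /legendre dvdz0 rmorph0. Qed.

Let chi_sqr (x : 'F_r) : chi x ^+ 2 = (x != 0)%:R.
Proof.
have [->|x_neq0] := eqVneq x 0; first by rewrite chi0 expr0n.
have : legendre (x : nat)%:Z r != 0.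
  by rewrite legendre_eq0 (dvdz_pcharf (pchar_Fp r_pr)) -pmulrn natr_Zp.
rewrite /chi -rmorphXn /=.
by case: (legendre_val (x : nat)%:Z r) => -> //; rewrite ?sqrrN ?expr1n.
Qed.

Let eD (x y : 'F_r) : e (x + y) = e x * e y.
Proof.
rewrite /e -exprD -(prim_expr_mod zP (x + y)%N) -val_Fp_nat // natrD.
by rewrite !natr_Zp.
Qed.

Let eMn (x : 'F_r) n : e (x *+ n) = e x ^+ n.
Proof. by elim: n => [|n IH]; rewrite ?mulr0n ?expr0 // mulrS exprS eD IH. Qed.

Let e_eq1 (x : 'F_r) : (e x == 1) = (x == 0).
Proof.
rewrite /e -(prim_order_dvd zP) -[x in RHS]natr_Zp -(dvdn_pcharf (pchar_Fp r_pr)).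
by [].
Qed.

(** Orthogonality: for nonzero y, translating x by 1 multiplies the sum by e y, which is not 1. *)
Let sum_e (y : 'F_r) : \sum_x e (x * y) = (r * (y == 0))%:R.
Proof.
have [->|y_neq0] := eqVneq y 0.
  under eq_bigr do rewrite mulr0 /e expr0.
  by rewrite sumr_const card_Fp // muln1.
rewrite muln0; apply/eqP.
have : e y * \sum_x e (x * y) = \sum_x e (x * y).
  rewrite mulr_sumr [RHS](reindex_inj (addrI 1)) /=; apply: eq_bigr => x _.
  by rewrite mulrDl mul1r eD.
move/eqP; rewrite -subr_eq0 -[X in _ - X]mul1r -mulrBl mulf_eq0 subr_eq0.
by rewrite e_eq1 (negPf y_neq0).
Qed.

Let two_neq0 : (2 : F) != 0.
Proof.
rewrite -(dvdn_pcharf charF) gtnNdvd //; exact: odd_prime_gt2.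
Qed.

(** Multiplying the variable by a nonresidue changes the sign of the sum, and 2 is invertible in
    [F]. *)
Let sum_chi : \sum_x chi x = 0.
Proof.
have [n nP] := exists_nonresidue r_pr r_odd.
have chin : chi n%:R = -1.
  by rewrite (@chi_int n) // nP rmorphN rmorph1.
have n_neq0 : (n%:R : 'F_r) != 0.
  apply: contra_eq_neq chin => ->; by rewrite chi0 eq_sym oppr_eq0 oner_eq0.
have : \sum_x chi x = - \sum_x chi x.
  rewrite [LHS](reindex_inj (mulfI n_neq0)) /= -sumrN; apply: eq_bigr => x _.
  by rewrite chiM chin mulN1r.
move/eqP; rewrite -subr_eq0 opprK -mulr2n -mulr_natl mulf_eq0.
by rewrite (negPf two_neq0) => /eqP.
Qed.

Let tau := \sum_x chi x * e x.

Let tau_sqr : tau ^+ 2 = chi (-1) * r%:R.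
Proof.
rewrite expr2 {1}/tau mulr_suml.
(* The inner variable is replaced by x y, so that the two exponentials merge; the terms with x = 0
   vanish on both sides. *)
transitivity (\sum_x \sum_y (chi x ^+ 2 * chi y) * e (x * (1 + y))).
  apply: eq_bigr => x _; have [->|x_neq0] := eqVneq x 0.
    by rewrite chi0 !mul0r big1 // => y _; rewrite expr0n !mul0r.
  rewrite /tau mulr_sumr [LHS](reindex_inj (mulfI x_neq0)) /=.
  apply: eq_bigr => y _; rewrite mulrDr mulr1 eD chiM; ring.
rewrite exchange_big /=.
(* As chi x ^ 2 = 1 except at x = 0, the sum over x is the orthogonality sum minus its term at 0.
   The -1 then contributes the sum of chi, which is 0, and only y = -1 survives. *)
transitivity (\sum_y chi y * ((r * (1 + y == 0))%:R - 1)).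
  apply: eq_bigr => y _; rewrite -sum_e mulrBr mulr1 mulr_sumr.
  rewrite (bigD1 0) //= chi_sqr eqxx !mul0r add0r.
  rewrite [in RHS](bigD1 0) //= mul0r {2}/e expr0 mulr1 addrAC subrr add0r.
  by apply: eq_bigr => x x_neq0; rewrite chi_sqr x_neq0 mul1r.
under eq_bigr do rewrite mulrBr mulr1.
rewrite sumrB sum_chi subr0 (bigD1 (-1)) //= subrr eqxx muln1 big1 ?addr0 //.
move=> y y_neq; rewrite addrC addr_eq0 (negPf y_neq) muln0 mulr0 //.
Qed.

(** Frobenius fixes the values of chi, which come from integers, and sends e x to e (p x).
    Substituting p x for the variable brings out chi p, whose square is 1. *)
Let tau_pow : tau ^+ p = chi p%:R * tau.
Proof.
rewrite -(pFrobenius_autE charF) rmorph_sum /= /tau mulr_sumr.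
have p_neq0 : (p%:R : 'F_r) != 0.
  by rewrite -(dvdn_pcharf (pchar_Fp r_pr)) dvdn_prime2 // eq_sym.
rewrite [RHS](reindex_inj (mulfI p_neq0)) /=; apply: eq_bigr => x _.
rewrite rmorphM /= {1}/chi pFrobenius_aut_int -/(chi x) pFrobenius_autE.
by rewrite mulrA chiM mulrA -expr2 chi_sqr p_neq0 mul1r mulr_natl eMn.
Qed.

(** The argument on the left is tau ^ 2, so Euler's criterion in [F] turns its symbol into tau ^ (p
    - 1), and [tau_pow] says that this is chi p once tau is cancelled. Since tau ^ 2 = r up to sign,
    p != r makes tau nonzero. *)
Lemma gauss_sum_reciprocity :
  legendre (if (r %% 4 == 1)%N then r%:Z else - r%:Z) p = legendre p r.
Proof.
apply: (sign_inj_char (odd_prime_gt2 p_odd p_pr) charF); try exact: legendre_val.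
rewrite -(legendre_pow _ p_pr p_odd charF).
have chiN1 : chi (-1) = (legendre (-1) r)%:~R.
  by apply: chi_int; rewrite rmorphN rmorph1.
have -> : (if (r %% 4 == 1)%N then r%:Z else - r%:Z)%:~R = tau ^+ 2.
  rewrite tau_sqr chiN1 legendreN1 //; case: ifP => _; first by rewrite mul1r.
  by rewrite !rmorphN rmorph1 mulN1r.
rewrite -exprM mulnC odd_prime_half //.
have tau_neq0 : tau != 0.
  rewrite -sqrf_eq0 tau_sqr chiN1 mulf_eq0 negb_or.
  rewrite -(dvdn_pcharf charF) dvdn_prime2 // p_neq_r andbT legendreN1 //.
  by case: ifP; rewrite ?rmorphN rmorph1 ?oppr_eq0 oner_eq0.
apply: (mulfI tau_neq0); rewrite -exprS prednK ?prime_gt0 // tau_pow mulrC.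
by congr (_ * _); apply: chi_int.
Qed.

End GaussSum.

Lemma quadratic_reciprocity (p r : nat) : prime p -> odd p -> prime r -> odd r ->
  p != r -> legendre (if (r %% 4 == 1)%N then r%:Z else - r%:Z) p = legendre p r.
Proof.
move=> p_pr p_odd r_pr r_odd p_neq_r.
have p_r : coprime p r by rewrite prime_coprime // dvdn_prime2.
have [F [charF [z zP]]] := prim_root_in_char p_pr (prime_gt0 r_pr) p_r.
exact: (gauss_sum_reciprocity p_pr p_odd r_pr r_odd p_neq_r charF zP).
Qed.

Lemma legendre2 (p : nat) : prime p -> odd p ->
  legendre 2 p = if (p %% 8 == 1)%N || (p %% 8 == 7)%N then 1 else -1.
Proof.
move=> p_pr p_odd; have p_gt2 : (2 < p)%N by apply: odd_prime_gt2.
have p8 : coprime p 8 by rewrite (@coprimeXr 3 p 2) ?coprimen2.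
have [F [charF [z zP]]] := prim_root_in_char p_pr (isT : 0 < 8)%N p8.
apply: (sign_inj_char p_gt2 charF); first exact: legendre_val.
  by case: ifP; [constructor 2|constructor 3].
have z4 : z ^+ 4 = -1.
  have /eqP : (z ^+ 4) ^+ 2 = 1 by rewrite -exprM (prim_expr_order zP).
  by rewrite sqrf_eq1 -(prim_order_dvd zP) => /orP[//|/eqP].
(* This is z + 1/z, a square root of 2, because z ^ 2 + 1/z ^ 2 = 0 when z ^ 4 = -1. Its p-th power
   depends only on p modulo 8. *)
pose tau := z + z ^+ 7.
have tau2 : tau ^+ 2 = 2.
  have -> : tau ^+ 2 = z ^+ 2 + z ^+ 4 * z ^+ 4 * 2 + z ^+ 4 * z ^+ 4 * z ^+ 4 * z ^+ 2.
    by rewrite /tau; ring.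
  by rewrite z4; ring.
rewrite -(legendre_pow _ p_pr p_odd charF) -[X in X ^+ _]/(2 : F) -tau2.
have tau_neq0 : tau != 0.
  by rewrite -sqrf_eq0 tau2 -(dvdn_pcharf charF) gtnNdvd.
rewrite -exprM mulnC odd_prime_half //.
apply: (mulfI tau_neq0); rewrite -exprS prednK ?prime_gt0 //.
rewrite -(pFrobenius_autE charF) rmorphD /= rmorphXn /= !pFrobenius_autE -exprM.
rewrite -(prim_expr_mod zP p) -(prim_expr_mod zP (_ * _)) -modnMml.
have z5 : z ^+ 5 = - z by rewrite exprS z4 mulrN1.
have z7 : z ^+ 7 = - z ^+ 3 by rewrite (exprD z 4 3) z4 mulN1r.
have : (p %% 8 \in [:: 1; 3; 5; 7])%N.
  have := ltn_pmod p (isT : 0 < 8)%N; have : odd (p %% 8) by lia.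
  by case: (p %% 8)%N => [|[|[|[|[|[|[|[|]]]]]]]].
rewrite !inE => /or4P[]/eqP -> /=; rewrite /tau ?z5 ?z7 ?expr1;
  rewrite ?rmorphN ?rmorph1; ring.
Qed.

(** * The symbol of g0 as a function of the residue modulo 8 * gtilde *)

Definition chi4 (n : nat) : int := if (n %% 4 == 1)%N then 1 else -1.

Definition chi8 (n : nat) : int :=
  if (n %% 8 == 1)%N || (n %% 8 == 7)%N then 1 else -1.

(** For odd [n] this is (2/n) if [e], times (-1/n) if [t]: the part of (g0/n) that remains after
    reciprocity has produced the symbol (n/gtilde). *)
Definition chi_sym (e t : bool) (n : nat) : int :=
  (if e then chi8 n else 1) * (if t then chi4 n else 1).

Lemma legendre_prodl (I : Type) (s : seq I) (F : I -> int) (p : nat) :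
  prime p -> odd p ->
  legendre (\prod_(i <- s) F i) p = \prod_(i <- s) legendre (F i) p.
Proof.
move=> p_pr p_odd; apply: (big_morph (fun a => legendre a p)).
  by move=> a b; rewrite legendreM.
exact: legendre1.
Qed.

(** The sign attached to [r] in [quadratic_reciprocity] is moved out as (-1/p), a condition on [p]
    alone. *)
Lemma prime_legendre (r p : nat) : prime p -> odd p -> prime r -> odd r ->
  p != r -> legendre r p = (if (r %% 4 == 3)%N then chi4 p else 1) * legendre p r.
Proof.
move=> p_pr p_odd r_pr r_odd p_neq_r.
rewrite -(quadratic_reciprocity p_pr p_odd r_pr r_odd) //.
have -> : (r %% 4 == 3)%N = ~~ (r %% 4 == 1)%N by lia.
case: (_ == _) => /=; first by rewrite mul1r.
by rewrite /chi4 -legendreN1 // -legendreM // mulrNN mul1r.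
Qed.

(** Phrased through exponents because this is what makes the Jacobi symbol a plain product of
    Legendre symbols. *)
Definition sqfreeb (m : nat) := (0 < m)%N && all (fun r => logn r m == 1)%N (primes m).

Lemma sqfreeb_prod (m : nat) : sqfreeb m -> (\prod_(r <- primes m) r)%N = m.
Proof.
case/andP=> m_gt0 /allP m1; rewrite [RHS]prod_prime_decomp // prime_decompE.
rewrite big_map big_seq [in RHS]big_seq; apply: eq_bigr => r /m1 /eqP /= ->.
by rewrite expn1.
Qed.

Lemma jacobi_sqfree (a : int) (m : nat) : sqfreeb m ->
  jacobi a m = \prod_(r <- primes m) legendre a r.
Proof.
case/andP=> m_gt0 /allP m1; rewrite /jacobi big_seq [in RHS]big_seq.
by apply: eq_bigr => r /m1 /eqP ->.
Qed.

Lemma jacobi_prime (a : int) (p : nat) : prime p -> jacobi a p = legendre a p.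
Proof.
by move=> p_pr; rewrite /jacobi primes_prime // big_seq1 logn_prime // eqxx.
Qed.

(** A product of odd numbers is 3 modulo 4 exactly when an odd number of its factors is. This
    collects the reciprocity signs of the prime factors of a composite number. *)
Lemma prod_chi4_mod4 (s : seq nat) (c : int) : all odd s -> c ^+ 2 = 1 ->
  \prod_(r <- s) (if (r %% 4 == 3)%N then c else 1)
  = if ((\prod_(r <- s) r) %% 4 == 3)%N then c else 1.
Proof.
move=> + c2; elim: s => [|r s IH] /=; first by rewrite !big_nil.
case/andP=> r_odd s_odd; rewrite !big_cons IH //.
have : odd (\prod_(r <- s) r)%N.
  elim: s {IH} s_odd => [|x s IH] /=; first by rewrite big_nil.
  by case/andP=> x_odd s_odd; rewrite big_cons oddM x_odd IH.
move: (\prod_(r <- s) r)%N => m m_odd; rewrite -modnMm.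
have [->|->] : (r %% 4 = 1 \/ r %% 4 = 3)%N by lia.
  have [->|->] : (m %% 4 = 1 \/ m %% 4 = 3)%N by lia.
    by rewrite /= mulr1.
  by rewrite /= mul1r.
have [->|->] : (m %% 4 = 1 \/ m %% 4 = 3)%N by lia.
  by rewrite /= mulr1.
by rewrite /= -expr2.
Qed.

Lemma jacobi_legendre (m p : nat) : prime p -> odd p -> odd m -> sqfreeb m ->
  ~~ (p %| m)%N ->
  legendre m p = (if (m %% 4 == 3)%N then chi4 p else 1) * jacobi p m.
Proof.
move=> p_pr p_odd m_odd m_sf p_m; have m_gt0 : (0 < m)%N by case/andP: m_sf.
have odd_r r : r \in primes m -> odd r.
  by rewrite mem_primes => /and3P[_ _ /dvdn_odd]; apply.
rewrite jacobi_sqfree // -{1 2}(sqfreeb_prod m_sf).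
rewrite -prod_chi4_mod4; last by rewrite /chi4; case: ifP.
  rewrite -big_split /= (big_morph Posz PoszM erefl) legendre_prodl //.
  rewrite big_seq [in RHS]big_seq; apply: eq_bigr => r r_m.
  have := r_m; rewrite mem_primes => /and3P[r_pr _ r_dvd].
  apply: prime_legendre => //; first exact: odd_r.
  by apply: contraNneq p_m => ->.
by apply/allP => r; apply: odd_r.
Qed.

(* Whether (g0 / n), for odd n prime to g0, involves the character modulo 4; when
   g0 is odd this is g0 = 3 mod 4. *)
Definition tsign (g0 : int) : bool := (gtilde g0 %% 4 == 3)%N (+) (g0 < 0).

Lemma squarefree_neq0 (g0 : int) : squarefree g0 -> g0 != 0.
Proof. by move=> sf; apply/eqP => g00; have := sf 0; rewrite g00 dvdz0; move=> /(_ isT). Qed.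

Lemma gtildeE (g0 : int) : squarefree g0 ->
  g0 = (if g0 < 0 then -1 else 1 : int) * (if odd `|g0|%N then 1 else 2 : int)
       * (gtilde g0)%:Z.
Proof.
move=> sf; rewrite /gtilde; by case: (boolP (odd _)) => g0_par; case: ltrP => g0_sg /=; lia.
Qed.

Lemma odd_gtilde (g0 : int) : squarefree g0 -> odd (gtilde g0).
Proof.
move=> sf; rewrite /gtilde; case: ifP => // g0_even.
case: (boolP (odd _)) => // even_half; have := sf 2; case/(_ _)/orP => //.
by apply/dvdzP; exists (g0 %/ 4)%Z; lia.
Qed.

Lemma sqfreeb_gtilde (g0 : int) : squarefree g0 -> sqfreeb (gtilde g0).
Proof.
move=> sf; have g0_neq0 := squarefree_neq0 sf; have g0E := gtildeE sf.
have gt_gt0 : (0 < gtilde g0)%N by have := odd_gtilde sf; case: gtilde.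
rewrite /sqfreeb gt_gt0; apply/allP => r r_gt.
rewrite eqn_leq logn_gt0 r_gt andbT leqNgt.
have r_pr : prime r by move: r_gt; rewrite mem_primes => /andP[].
apply: contraTN r_pr; rewrite -pfactor_dvdn => // ; last first.
  by move: r_gt; rewrite mem_primes => /andP[].
case/dvdnP=> k gtE; have : (r%:Z ^+ 2 %| g0)%Z.
  apply/dvdzP; exists ((if g0 < 0 then -1 else 1 : int) * (if odd `|g0|%N then 1 else 2 : int) * k%:Z).
  by rewrite [LHS]g0E gtE -mulnn !PoszM expr2 !mulrA.
by move/sf/orP => -[/eqP[->]|/eqP].
Qed.

(** A factor (-1/p) can come from the sign of [g0] and from reciprocity for [gtilde g0]. Two of them
    cancel, hence the exclusive or in [tsign]. The factor 2 of an even [g0] gives (2/p). *)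
Lemma legendre_gtilde (g0 : int) (p : nat) : squarefree g0 -> prime p -> odd p ->
  ~~ (p %| g0)%Z ->
  legendre g0 p = chi_sym (~~ odd `|g0|%N) (tsign g0) p * jacobi p (gtilde g0).
Proof.
move=> sf p_pr p_odd p_g0.
rewrite {1}(gtildeE sf) !legendreM // jacobi_legendre ?odd_gtilde ?sqfreeb_gtilde //.
  rewrite mulrA; congr (_ * _); rewrite /chi_sym /tsign.
  rewrite (fun_if (legendre^~ p)) [legendre (if _ then 1 else 2) p](fun_if (legendre^~ p)).
  rewrite legendreN1 // legendre1 // legendre2 // -/(chi4 p) -/(chi8 p).
  have [->|->] : chi4 p = 1 \/ chi4 p = -1 by rewrite /chi4; case: ifP; auto.
    by rewrite !if_same !mulr1 mul1r if_neg.
  by case: (odd _); case: (g0 < 0); case: (_ == 3)%N => /=; ring.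
apply: contra p_g0 => p_gt; rewrite (gtildeE sf) dvdz_mull //.
Qed.

Lemma tsign_odd (g0 : int) : squarefree g0 -> odd `|g0|%N ->
  tsign g0 = (g0 != 1 %[mod 4])%Z.
Proof.
move=> sf g0_odd; rewrite /tsign /gtilde g0_odd; case: ltrP => g0_sg /=.
  by rewrite addbT; apply/idP/idP; lia.
by rewrite addbF; apply/idP/idP; lia.
Qed.

(** [Delta] with the symbols rewritten by reciprocity, so that it becomes periodic. Both agree at
    the prime pairs that avoid the divisors of [g], in particular for p > |g| when [g] is
    nonzero. *)
Definition Delta_per (d : nat) (g0 : int) (n : nat) : bool :=
  let c m := chi_sym (~~ odd `|g0|%N) (tsign g0) m * jacobi m (gtilde g0) in
  (c n == -1) && (c (n + d)%N == -1).

Lemma Delta_prime (d p : nat) (g g0 gs : int) : g = g0 * gs ^+ 2 -> squarefree g0 ->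
  prime p -> odd p -> prime (p + d) -> odd (p + d) ->
  ~~ (p %| g)%Z -> ~~ (p + d %| g)%Z -> Delta d g p = Delta_per d g0 p.
Proof.
move=> gE sf p_pr p_odd pd_pr pd_odd p_g pd_g.
have leg q : prime q -> odd q -> ~~ (q %| g)%Z ->
    jacobi g q = chi_sym (~~ odd `|g0|%N) (tsign g0) q * jacobi q (gtilde g0).
  move=> q_pr q_odd q_g; rewrite jacobi_prime // gE legendreM // legendre_sqr //.
    rewrite mulr1 legendre_gtilde //.
    by apply: contra q_g => q_g; rewrite gE dvdz_mulr.
  by apply: contra q_g => q_g; rewrite gE expr2 mulrA dvdz_mull.
by rewrite /Delta /Delta_per !leg.
Qed.

(** * Averages over admissible residue classes *)

Definition mod_periodic (T : Type) (q : nat) (f : nat -> T) :=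
  forall n, f (n %% q)%N = f n.

Lemma periodic_dvdn (T : Type) (q Q : nat) (f : nat -> T) :
  (q %| Q)%N -> mod_periodic q f -> mod_periodic Q f.
Proof. by move=> qQ fP n; rewrite -fP modn_dvdm // fP. Qed.

Lemma periodic_shift (T : Type) (q d : nat) (f : nat -> T) :
  mod_periodic q f -> mod_periodic q (fun n => f (n + d)%N).
Proof. by move=> fP n; rewrite -fP modnDml fP. Qed.

Lemma periodic_map2 (T1 T2 T : Type) (q : nat) (h : T1 -> T2 -> T) f g :
  mod_periodic q f -> mod_periodic q g -> mod_periodic q (fun n => h (f n) (g n)).
Proof. by move=> fP gP n; rewrite fP gP. Qed.

Lemma coprime_periodic (q : nat) : mod_periodic q (coprime^~ q).
Proof. by move=> n; rewrite coprime_modl. Qed.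

Definition adm (d q a : nat) : bool := coprime a q && coprime (a + d) q.

Lemma adm_periodic (d q : nat) : mod_periodic q (adm d q).
Proof.
apply: (periodic_map2 andb); first exact: coprime_periodic.
exact: (periodic_shift d (@coprime_periodic q)).
Qed.

Lemma adm_mul (d m n a : nat) : adm d (m * n) a = adm d m a && adm d n a.
Proof. by rewrite /adm !coprimeMr andbACA. Qed.

Section AdmissibleAverage.

Variable R : realFieldType.
Implicit Types (f h : nat -> R) (d q m n p k : nat).

Lemma sum_crt m n f h : (0 < m)%N -> (0 < n)%N -> coprime m n ->
  mod_periodic m f -> mod_periodic n h ->
  \sum_(0 <= a < m * n) f a * h a
  = (\sum_(0 <= a < m) f a) * (\sum_(0 <= a < n) h a).
Proof.
move=> m_gt0 n_gt0 mn fP hP; rewrite !big_mkord big_distrlr /= pair_big /=.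
pose F (x : 'I_(m * n)) : 'I_m * 'I_n :=
  (Ordinal (ltn_pmod x m_gt0), Ordinal (ltn_pmod x n_gt0)).
have F_inj : injective F.
  move=> x y [] /eqP xm /eqP xn; apply/val_inj => /=.
  rewrite -(modn_small (ltn_ord x)) -(modn_small (ltn_ord y)); apply/eqP.
  by rewrite chinese_remainder // xm xn.
rewrite (reindex F) /=; last first.
  by apply/onW_bij/inj_card_bij => //; rewrite card_prod !card_ord.
by apply: eq_bigr => x _; rewrite fP hP.
Qed.

Lemma sum_blocks q m f : mod_periodic q f ->
  \sum_(0 <= a < m * q) f a = m%:R * \sum_(0 <= a < q) f a.
Proof.
move=> fP; elim: m => [|m IH]; first by rewrite mul0n big_nil mul0r.
rewrite mulSnr (@big_cat_nat _ _ _ (m * q)%N) ?leq_addr //= IH -natr1 mulrDl mul1r.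
congr (_ + _); rewrite -{1}[(m * q)%N]add0n big_addn addKn.
by apply: eq_bigr => a _; rewrite -fP addnC modnMDl fP.
Qed.

Lemma sum_shift q d f : mod_periodic q f ->
  \sum_(0 <= a < q) f (a + d)%N = \sum_(0 <= a < q) f a.
Proof.
move=> fP; elim: d => [|d IH]; first by under eq_bigr do rewrite addn0.
rewrite -[RHS]IH; under eq_bigr do rewrite addnS -addSn.
have fdP := periodic_shift d fP.
rewrite -(@big_add1 _ _ _ 0 q.+1 xpredT (fun a => f (a + d)%N)).
case: q fP fdP {IH} => [|q] fP fdP; first by rewrite !big_nil.
rewrite big_nat_recr //= [RHS]big_nat_recl // addrC; congr (_ + _).
  by rewrite -(fdP q.+1) modnn.
by rewrite big_add1.
Qed.

Definition admsum d q f : R := \sum_(0 <= a < q | adm d q a) f a.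

Definition admcount d q : R := admsum d q (fun=> 1).

Definition admavg d q f : R := admsum d q f / admcount d q.

Lemma admsumE d q f : admsum d q f = \sum_(0 <= a < q) (adm d q a)%:R * f a.
Proof.
rewrite /admsum big_mkcond; apply: eq_bigr => a _.
by case: adm; rewrite ?mul1r ?mul0r.
Qed.

Lemma eq_admsum d q f h : (forall a, adm d q a -> f a = h a) ->
  admsum d q f = admsum d q h.
Proof. by move=> fh; apply: eq_bigr => a /fh. Qed.

Lemma admsumM d m n f h : (0 < m)%N -> (0 < n)%N -> coprime m n ->
  mod_periodic m f -> mod_periodic n h ->
  admsum d (m * n) (fun a => f a * h a) = admsum d m f * admsum d n h.
Proof.
move=> m_gt0 n_gt0 mn fP hP; rewrite !admsumE -sum_crt //.
- apply: eq_bigr => a _; rewrite adm_mul -mulnb natrM; ring.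
- by apply: (periodic_map2 (fun (b : bool) (x : R) => b%:R * x)) => //; apply: adm_periodic.
- by apply: (periodic_map2 (fun (b : bool) (x : R) => b%:R * x)) => //; apply: adm_periodic.
Qed.

Lemma admcountM d m n : (0 < m)%N -> (0 < n)%N -> coprime m n ->
  admcount d (m * n) = admcount d m * admcount d n.
Proof.
move=> m_gt0 n_gt0 mn; rewrite /admcount -admsumM //.
by apply: eq_admsum => a _; rewrite mulr1.
Qed.

(** No new prime enters the modulus, so each admissible class modulo [q] lifts to [p] admissible
    classes. *)
Lemma admsum_dvd d q p f : (p %| q)%N -> mod_periodic q f ->
  admsum d (q * p) f = p%:R * admsum d q f.
Proof.
move=> pq fP; rewrite !admsumE mulnC -sum_blocks.
  apply: eq_bigr => a _; rewrite adm_mul; case/boolP: (adm d q a) => [|_].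
    by case/andP=> aq adq; rewrite /adm !(coprime_dvdr pq).
  by rewrite andbF.
by apply: (periodic_map2 (fun (b : bool) (x : R) => b%:R * x)) => //; apply: adm_periodic.
Qed.

Lemma admsum_mod1 d k h (b : nat) : (0 < k)%N -> mod_periodic k h ->
  admsum d k (fun a => (a == b %[mod k])%N%:R * h a) = (adm d k b)%:R * h b.
Proof.
move=> k_gt0 hP; rewrite admsumE (bigD1_seq (b %% k)%N) ?iota_uniq //=; last first.
  by rewrite mem_index_iota ltn_pmod.
rewrite modn_mod eqxx mul1r adm_periodic hP big_seq_cond big1 ?addr0 // => a.
rewrite mem_index_iota => /andP[/andP[_ a_k] ab].
by rewrite (modn_small a_k) (negPf ab) mul0r mulr0.
Qed.

Lemma admsum_ge0 d q f : (forall a, 0 <= f a) -> 0 <= admsum d q f.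
Proof. by move=> f_ge0; apply: sumr_ge0. Qed.

Lemma ler_admsum d q f h : (forall a, f a <= h a) -> admsum d q f <= admsum d q h.
Proof. by move=> fh; apply: ler_sum. Qed.

Lemma admcount_prime d p : prime p ->
  admcount d p = if (p %| d)%N then p%:R - 1 else p%:R - 2.
Proof.
move=> p_pr; have p_gt0 := prime_gt0 p_pr.
(* The class of -d. Admissibility at p excludes the classes 0 and b, which coincide exactly when p
   divides d. *)
pose b := ((p - d %% p) %% p)%N.
have bE a : (p %| a + d)%N = (a == b %[mod p]).
  rewrite -(eqn_modDr d) modnDml; have -> : (p - d %% p + d = 0 %[mod p])%N.
    rewrite -modnDmr subnK ?modnn ?mod0n //; exact/ltnW/ltn_pmod.
  by rewrite /dvdn mod0n.
have ind c : \sum_(0 <= a < p) (a == c %[mod p])%N%:R = 1 :> R.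
  rewrite (bigD1_seq (c %% p)%N) ?iota_uniq //=; last first.
    by rewrite mem_index_iota ltn_pmod.
  rewrite modn_mod eqxx big_seq_cond big1 ?addr0 // => a.
  rewrite mem_index_iota => /andP[/andP[_ a_k] ab].
  by rewrite (modn_small a_k) (negPf ab).
rewrite /admcount admsumE.
transitivity (\sum_(0 <= a < p) (1 - (a == 0 %[mod p])%N%:R
   - (~~ (p %| d)%N)%:R * (a == b %[mod p])%N%:R : R)).
  apply: eq_bigr => a _; rewrite mulr1 /adm !(coprime_sym _ p) !prime_coprime //.
  rewrite bE; have -> : (a == 0 %[mod p])%N = (p %| a)%N by rewrite mod0n.
  have : (p %| a)%N -> (a == b %[mod p])%N = (p %| d)%N.
    by move=> pa; rewrite -bE dvdn_addr.
  have : (p %| d)%N -> (a == b %[mod p])%N = (p %| a)%N.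
    by move=> pd; rewrite -bE dvdn_addl.
  case: (p %| a)%N; case: (p %| d)%N; case: (a == b %[mod p])%N => //= H1 H2;
  by [lra | case: (H1 isT) | case: (H2 isT)].
rewrite !sumrB -mulr_sumr !ind sumr_const_nat subn0.
by case: (p %| d)%N => /=; lra.
Qed.

(** The case p = 2 rests on the parity of [d]: an odd [d] would leave 2 - 2 = 0 admissible
    classes. *)
Lemma admcount_prime_ge1 d p : ~~ odd d -> prime p -> 1 <= admcount d p.
Proof.
move=> d_even p_pr; rewrite admcount_prime //.
have [->|p_neq2] := eqVneq p 2%N; first by rewrite dvdn2 d_even; lra.
have : (3 <= p)%N by have := prime_gt1 p_pr; lia.
by rewrite -(ler_nat R) => p3; case: ifP => _; lra.
Qed.

Lemma admcount1 d : admcount d 1 = 1.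
Proof.
by rewrite /admcount admsumE big_nat1 /adm !coprimen1 mulr1.
Qed.

Lemma admcount_mul_prime d q p : (0 < q)%N -> prime p ->
  admcount d (q * p) = admcount d q * (if (p %| q)%N then p%:R else admcount d p).
Proof.
move=> q_gt0 p_pr; case: ifP => pq; first by rewrite /admcount admsum_dvd // mulrC.
by rewrite admcountM ?(prime_gt0 p_pr) // coprime_sym prime_coprime // pq.
Qed.

Lemma admcount_ge1 d q : ~~ odd d -> (0 < q)%N -> 1 <= admcount d q.
Proof.
move=> d_even; elim/ltn_ind: q => q IH q_gt0.
have [q1|q_neq1] := eqVneq q 1%N; first by rewrite q1 admcount1.
have q_gt1 : (1 < q)%N by lia.
have p_pr := pdiv_prime q_gt1.
have [m qE] := dvdnP (pdiv_dvd q).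
have m_gt0 : (0 < m)%N by move: q_gt0; rewrite qE muln_gt0 => /andP[].
rewrite qE admcount_mul_prime // mulr_ege1 //.
  by apply: IH => //; rewrite [X in (_ < X)%N]qE ltn_Pmulr // prime_gt1.
case: ifP => _; last exact: admcount_prime_ge1.
by rewrite ler1n prime_gt0.
Qed.

(** The primes of [m] are moved into the modulus one at a time. A prime already present multiplies
    both the sum and the count by p; a new one multiplies both by [admcount d p]. *)
Lemma admavg_mul d q m f : ~~ odd d -> (0 < q)%N -> (0 < m)%N -> mod_periodic q f ->
  admavg d (q * m) f = admavg d q f.
Proof.
move=> d_even; elim/ltn_ind: m q => m IH q q_gt0 m_gt0 fP.
have [->|m_neq1] := eqVneq m 1%N; first by rewrite muln1.
have m_gt1 : (1 < m)%N by lia.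
have p_pr := pdiv_prime m_gt1; set p := pdiv m in p_pr *.
have [n mE] := dvdnP (pdiv_dvd m); rewrite -/p in mE.
have n_gt0 : (0 < n)%N by move: m_gt0; rewrite mE muln_gt0 => /andP[].
have neq0 k : (0 < k)%N -> admcount d k != 0.
  by move=> /(admcount_ge1 d_even) k1; apply/lt0r_neq0/(lt_le_trans ltr01).
rewrite mE [(n * p)%N]mulnC mulnA IH ?muln_gt0 ?q_gt0 ?(prime_gt0 p_pr) //; last 2 first.
- by rewrite [X in (_ < X)%N]mE ltn_Pmulr // prime_gt1.
- by apply: periodic_dvdn fP; rewrite dvdn_mulr.
rewrite /admavg admcount_mul_prime //; case: ifP => pq.
  rewrite admsum_dvd // [p%:R * _]mulrC -mulf_div divff ?mulr1 //.
  by rewrite pnatr_eq0 -lt0n prime_gt0.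
have -> : admsum d (q * p) f = admsum d q f * admcount d p.
  rewrite /admcount -admsumM ?(prime_gt0 p_pr) // 1?coprime_sym ?prime_coprime ?pq //.
  by apply: eq_admsum => a _; rewrite mulr1.
by rewrite -mulf_div divff ?mulr1 // neq0 ?prime_gt0.
Qed.

Lemma admavg_dvd d q Q f : ~~ odd d -> (0 < Q)%N -> (q %| Q)%N -> mod_periodic q f ->
  admavg d Q f = admavg d q f.
Proof.
move=> d_even Q_gt0 /dvdnP[m QE] fP; move: Q_gt0; rewrite {}QE muln_gt0 mulnC.
by case/andP=> m_gt0 q_gt0; rewrite admavg_mul.
Qed.

(* (p - 2)^2 >= p for p >= 5; the primes 2 and 3 account for the extra factors. *)
Lemma admcount_sqr_ge d k : ~~ odd d -> (0 < k)%N ->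
  k%:R <= (if (2 %| k)%N then 2 else 1) * (if (3 %| k)%N then 3 else 1)
          * admcount d k ^+ 2.
Proof.
move=> d_even; elim/ltn_ind: k => q IH q_gt0.
have [q1|q_neq1] := eqVneq q 1%N; first by rewrite q1 admcount1 /=; lra.
have q_gt1 : (1 < q)%N by lia.
have p_pr := pdiv_prime q_gt1; set p := pdiv q in p_pr *.
have [m qE] := dvdnP (pdiv_dvd q); rewrite -/p in qE.
have m_gt0 : (0 < m)%N by move: q_gt0; rewrite qE muln_gt0 => /andP[].
have m_lt : (m < q)%N by rewrite [X in (_ < X)%N]qE ltn_Pmulr // prime_gt1.
have := IH m m_lt m_gt0.
rewrite qE admcount_mul_prime // natrM exprMn !Euclid_dvdM //.
rewrite [(2 %| p)%N]dvdn_prime2 // [(3 %| p)%N]dvdn_prime2 //.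
set c2 : R := if (2 %| m)%N then 2 else 1; set c3 : R := if (3 %| m)%N then 3 else 1.
set A := admcount d m; move=> IHm.
have A2 : 0 <= A ^+ 2 by apply: sqr_ge0.
have p1 : 1 <= p%:R :> R by rewrite ler1n prime_gt0.
have c2p : 1 <= c2 by rewrite /c2; case: ifP; lra.
have c3p : 1 <= c3 by rewrite /c3; case: ifP; lra.
(* By the induction hypothesis only the contribution x of the prime p is left to compare; x is p if
   p divides m, and [admcount d p] otherwise. *)
have step (c2' c3' x : R) : c2 * c3 * p%:R <= c2' * c3' * x ^+ 2 ->
    m%:R * p%:R <= c2' * c3' * (A ^+ 2 * x ^+ 2).
  move=> hx; apply: (@le_trans _ _ (c2 * c3 * A ^+ 2 * p%:R)).
    by rewrite ler_wpM2r // (le_trans ler01).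
  rewrite [leLHS](_ : _ = A ^+ 2 * (c2 * c3 * p%:R)); last by ring.
  rewrite [leRHS](_ : _ = A ^+ 2 * (c2' * c3' * x ^+ 2)); last by ring.
  exact: ler_wpM2l.
apply: step; have c23 : 0 <= c2 * c3 by rewrite mulr_ge0 // (le_trans ler01).
case: (boolP (p %| m)%N) => [pm|/negbTE pm].
  have <- : c2 = (if (2 %| m)%N || (2 == p)%N then 2 else 1).
    by rewrite /c2; case: eqP => [p2|_]; rewrite ?orbF // p2 pm.
  have <- : c3 = (if (3 %| m)%N || (3 == p)%N then 3 else 1).
    by rewrite /c3; case: eqP => [p2|_]; rewrite ?orbF // p2 pm.
  by rewrite ler_wpM2l // expr2 ler_peMl // (le_trans ler01).
rewrite admcount_prime //.
have [p2|p_neq2] := eqVneq 2%N p.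
  have -> : (3 == p)%N = false by rewrite -p2.
  rewrite orbT orbF /c2 p2 pm -p2 dvdn2 d_even -/c3.
  rewrite (_ : 2%:R - 1 = 1 :> R); lra.
have [p3|p_neq3] := eqVneq 3%N p.
  rewrite orbT orbF /c3 p3 pm -p3 -/c2.
  by case: ifP => _; [rewrite (_ : 3%:R - 1 = 2 :> R)|rewrite (_ : 3%:R - 2 = 1 :> R)]; lra.
rewrite !orbF -/c2 -/c3 ler_wpM2l //.
have : (5 <= p)%N.
  case: (p) p_pr p_neq2 p_neq3 => [|[|[|[|[|p']]]]] //.
rewrite -(ler_nat R) => p5; case: ifP => _; nra.
Qed.

Lemma admcount_sqr_ge6 d k : ~~ odd d -> (0 < k)%N ->
  k%:R <= 6 * admcount d k ^+ 2.
Proof.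
move=> d_even k_gt0; apply: le_trans (admcount_sqr_ge d_even k_gt0) _.
by have := sqr_ge0 (admcount d k); do 2![case: ifP => _]; nra.
Qed.

Lemma admavg_le d q f h : (forall a, f a <= h a) -> ~~ odd d -> (0 < q)%N ->
  admavg d q f <= admavg d q h.
Proof.
move=> fh d_even q_gt0; rewrite /admavg ler_pM2r ?ler_admsum //.
by rewrite invr_gt0 (lt_le_trans ltr01) ?admcount_ge1.
Qed.

Lemma admavg_sum (I : Type) (s : seq I) d q (c : I -> R) (F : I -> nat -> R) :
  admavg d q (fun n => \sum_(i <- s) c i * F i n)
  = \sum_(i <- s) c i * admavg d q (F i).
Proof.
rewrite /admavg /admsum exchange_big /= mulr_suml; apply: eq_bigr => i _.
by rewrite -mulr_sumr mulrA.
Qed.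

Lemma admavgB d q f h : admavg d q (fun n => f n - h n) = admavg d q f - admavg d q h.
Proof. by rewrite /admavg /admsum sumrB mulrBl. Qed.

Lemma admavgD d q f h : admavg d q (fun n => f n + h n) = admavg d q f + admavg d q h.
Proof. by rewrite /admavg /admsum big_split mulrDl. Qed.

Lemma admavgZ d q c f : admavg d q (fun n => c * f n) = c * admavg d q f.
Proof. by rewrite /admavg /admsum -mulr_sumr mulrA. Qed.

Lemma ler_norm_admavg d q f : `|admavg d q f| <= admavg d q (fun n => `|f n|).
Proof.
rewrite /admavg normrM normfV [`|admcount d q|]ger0_norm; last first.
  by apply: admsum_ge0 => _; apply: ler01.
rewrite ler_wpM2r ?ler_norm_sum // invr_ge0; apply: admsum_ge0 => _.
exact: ler01.
Qed.

End AdmissibleAverage.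

Lemma sum_iota1 (V : nmodType) (q : nat) (f : nat -> V) : mod_periodic q f ->
  \sum_(a <- iota 1 q) f a = \sum_(0 <= a < q) f a.
Proof.
move=> fP; rewrite /index_iota subn0; case: q fP => [|q] fP //.
rewrite -[X in iota 1 X]addn1 iotaD big_cat /= big_cons big_nil addr0 big_cons.
by rewrite addrC -(fP (1 + q)%N) add1n modnn.
Qed.

Lemma size_phiset (R : realFieldType) (d q : nat) :
  (size (phiset d q))%:R = admcount R d q.
Proof.
rewrite /phiset size_filter -sum1_count big_mkcond /= natr_sum /admcount admsumE.
rewrite -sum_iota1; last by move=> n; rewrite adm_periodic.
by apply: eq_bigr => a _; rewrite mulr1 /adm; case: ifP.
Qed.

(** * Truncated expansion of the totient ratio *)

Section TruncatedTotient.

Variable R : rcfType.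
Implicit Types (d q m n p k y N W : nat).

(* mu(k) / k *)
Definition mobius_over k : R :=
  \prod_(p <- primes k) (if logn p k == 1 then - p%:R^-1 else 0).

Definition totient_ratio m : R := (totient m)%:R / m%:R.

Lemma totient_ratioE m : (0 < m)%N ->
  totient_ratio m = \prod_(p <- primes m) (1 - p%:R^-1).
Proof.
move=> m_gt0; rewrite /totient_ratio totientE // {3}[m]prod_prime_decomp //.
rewrite prime_decompE big_map !natr_prod -prodf_div /= big_seq [in RHS]big_seq.
apply: eq_bigr => p; rewrite mem_primes => /and3P[p_pr _ p_m].
have l_gt0 : (0 < logn p m)%N by rewrite logn_gt0 mem_primes p_pr m_gt0.
have p_neq0 : p%:R != 0 :> R by rewrite pnatr_eq0 -lt0n prime_gt0.
rewrite -{2}(prednK l_gt0) expnS !natrM -mulf_div divff ?mulr1; last first.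
  by rewrite pnatr_eq0 -lt0n expn_gt0 prime_gt0.
by rewrite -subn1 natrB ?prime_gt0 // mulrBl divff // mul1r.
Qed.

Lemma normr_mobius_over k : (0 < k)%N -> `|mobius_over k| <= k%:R^-1.
Proof.
move=> k_gt0; rewrite /mobius_over {3}[k]prod_prime_decomp // prime_decompE big_map.
rewrite natr_prod -prodfV normr_prod big_seq [leRHS]big_seq.
apply: ler_prod => p; rewrite mem_primes => /and3P[p_pr _ _] /=.
rewrite normr_ge0 /=; case: eqP => [->|_]; last by rewrite normr0 invr_ge0 ler0n.
by rewrite expn1 normrN ger0_norm // invr_ge0 ler0n.
Qed.

Lemma mobius_over_le1 k : (0 < k)%N -> `|mobius_over k| <= 1.
Proof.
move=> k_gt0; apply: le_trans (normr_mobius_over k_gt0) _.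
by rewrite invf_le1 ?ltr0n // ler1n.
Qed.

Lemma mobius_over_sqr p k : prime p -> (0 < k)%N -> (p ^ 2 %| k)%N ->
  mobius_over k = 0.
Proof.
move=> p_pr k_gt0; rewrite pfactor_dvdn // => l2; rewrite /mobius_over.
have p_k : p \in primes k by rewrite -logn_gt0 ltnW.
by rewrite (bigD1_seq p) ?primes_uniq //= gtn_eqF // mul0r.
Qed.

Lemma mobius_over_mul_prime p k : prime p -> (0 < k)%N -> ~~ (p %| k)%N ->
  mobius_over (p * k) = - p%:R^-1 * mobius_over k.
Proof.
move=> p_pr k_gt0 p_k; rewrite /mobius_over.
have -> : \prod_(r <- primes (p * k)) (if logn r (p * k) == 1 then - r%:R^-1 else 0)
        = \prod_(r <- p :: primes k) (if logn r (p * k) == 1 then - r%:R^-1 else 0 : R).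
  apply: perm_big; apply: uniq_perm; rewrite ?primes_uniq //=.
    by rewrite mem_primes (negPf p_k) !andbF primes_uniq.
  by move=> r; rewrite primesM ?(prime_gt0 p_pr) // primes_prime // !inE.
rewrite big_cons lognM ?(prime_gt0 p_pr) // logn_prime // eqxx.
have -> : logn p k = 0%N by apply/eqP; rewrite -leqn0 leqNgt logn_gt0 mem_primes (negPf p_k) !andbF.
congr (_ * _); rewrite big_seq [in RHS]big_seq; apply: eq_bigr => r.
rewrite mem_primes => /and3P[r_pr _ r_k].
rewrite lognM ?(prime_gt0 p_pr) // logn_prime //.
by have -> : (r == p)%N = false by apply: contraNF p_k => /eqP <-.
Qed.

(** Write m = n p^l with p prime to n. Divisors of m divisible by p^2 contribute nothing; the others
    are the k and the p k with k a divisor of n, and the latter carry the factor -1/p. This splits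
    off 1 - 1/p. *)
Lemma sum_mobius_over m : (0 < m)%N ->
  \sum_(k <- divisors m) mobius_over k = \prod_(p <- primes m) (1 - p%:R^-1).
Proof.
elim/ltn_ind: m => m IH m_gt0.
have [->|m_neq1] := eqVneq m 1%N.
  by rewrite big_cons !big_nil /mobius_over big_nil addr0.
have m_gt1 : (1 < m)%N by lia.
have p_pr := pdiv_prime m_gt1; set p := pdiv m in p_pr *.
have p_gt0 := prime_gt0 p_pr.
have p_m : (p %| m)%N by apply: pdiv_dvd.
have [n p_n mE] := pfactor_coprime p_pr m_gt0.
have n_gt0 : (0 < n)%N by move: m_gt0; rewrite mE muln_gt0 => /andP[].
have pn : ~~ (p %| n)%N by rewrite -prime_coprime.
have l_gt0 : (0 < logn p m)%N by rewrite logn_gt0 mem_primes p_pr m_gt0.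
have n_lt : (n < m)%N.
  by rewrite [X in (_ < X)%N]mE ltn_Pmulr // -(exp1n (logn p m)) ltn_exp2r // prime_gt1.
have -> : \prod_(r <- primes m) (1 - r%:R^-1)
   = \prod_(r <- p :: primes n) (1 - r%:R^-1 : R).
  apply: perm_big; apply: uniq_perm; rewrite ?primes_uniq //=.
    by rewrite mem_primes (negPf pn) !andbF primes_uniq.
  move=> r; rewrite {1}mE mulnC primesM ?expn_gt0 ?p_gt0 // primesX //.
  by rewrite primes_prime // !inE.
rewrite big_cons -IH // (bigID (fun k => p ^ 2 %| k)%N) /= big_seq_cond.
rewrite big1 ?add0r; last first.
  move=> k /andP[k_m p2]; apply: mobius_over_sqr p_pr _ p2.
  by move: k_m; rewrite -dvdn_divisors //; apply: dvdn_gt0.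
rewrite -big_filter.
have -> : \sum_(k <- [seq k <- divisors m | ~~ (p ^ 2 %| k)%N]) mobius_over k
   = \sum_(k <- divisors n ++ map (muln p) (divisors n)) mobius_over k.
  apply: perm_big; apply: uniq_perm.
  - by rewrite filter_uniq // divisors_uniq.
  - rewrite cat_uniq divisors_uniq map_inj_uniq ?divisors_uniq ?andbT; last first.
      by move=> a b /eqP; rewrite eqn_pmul2l // => /eqP.
    apply/hasPn => k /mapP[j _ ->]; rewrite -dvdn_divisors //.
    by apply: contra pn; apply: dvdn_trans; rewrite dvdn_mulr.
  move=> k; rewrite mem_filter mem_cat -!dvdn_divisors //.
  apply/idP/idP.
    case/andP=> p2 k_m; have k_gt0 : (0 < k)%N := dvdn_gt0 m_gt0 k_m.
    have [p_k|p_k] := boolP (p %| k)%N; last first.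
      move: k_m; rewrite {1}mE Gauss_dvdl ?coprimeXr // => [->//|].
      by rewrite coprime_sym prime_coprime.
    case/dvdnP: p_k => j kE; apply/orP; right; apply/mapP; exists j; last by rewrite mulnC.
    have pj : ~~ (p %| j)%N by apply: contra p2 => /dvdnP[i jE]; rewrite kE jE -mulnn -mulnA dvdn_mull.
    rewrite -dvdn_divisors //.
    have : (j %| m)%N by apply: dvdn_trans k_m; rewrite kE dvdn_mulr.
    rewrite mE Gauss_dvdl ?coprimeXr //.
    by rewrite coprime_sym prime_coprime.
  case/orP=> [k_n|/mapP[j]].
    apply/andP; split; last by rewrite mE dvdn_mulr.
    apply: contra pn => p2; apply: dvdn_trans k_n; apply: dvdn_trans p2.
    by rewrite expnS dvdn_mulr.
  rewrite -dvdn_divisors // => j_n ->; apply/andP; split.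
    rewrite expnS expn1 dvdn_pmul2l //; apply: contra pn => p_j.
    exact: dvdn_trans p_j j_n.
  rewrite mE mulnC dvdn_mul // -(prednK l_gt0) expnS dvdn_mulr //.
rewrite big_cat big_map /= mulrBl mul1r; congr (_ + _).
rewrite -mulNr mulr_sumr big_seq [in RHS]big_seq; apply: eq_bigr => k.
rewrite -dvdn_divisors // => k_n; rewrite mobius_over_mul_prime //.
  exact: dvdn_gt0 k_n.
by apply: contra pn => p_k; apply: dvdn_trans k_n.
Qed.

Lemma sum_divisors (F : nat -> R) m : (0 < m)%N ->
  \sum_(k <- divisors m) F k = \sum_(1 <= k < m.+1 | (k %| m)%N) F k.
Proof.
move=> m_gt0; rewrite -[RHS]big_filter; apply: perm_big; apply: uniq_perm.
- exact: divisors_uniq.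
- by rewrite filter_uniq // iota_uniq.
move=> k; rewrite mem_filter -dvdn_divisors // mem_index_iota.
case k_m: (k %| m)%N => //=.
by rewrite ltnS (dvdn_leq m_gt0 k_m) (dvdn_gt0 m_gt0 k_m).
Qed.

(* For n > 0 this is the product of 1 - 1/p over p | gcd (W, n - 1); stating it
   with a congruence makes it periodic, including at n = 0. *)
Definition local_ratio W n : R :=
  \prod_(p <- primes W) (1 - (n == 1 %[mod p])%N%:R / p%:R).

Lemma dvdn_mod1 p n : (0 < n)%N -> (n == 1 %[mod p])%N = (p %| n.-1)%N.
Proof. by move=> n_gt0; rewrite eqn_mod_dvd // subn1. Qed.

Lemma local_ratio_periodic W Q : (forall p, p \in primes W -> (p %| Q)%N) ->
  mod_periodic Q (local_ratio W).
Proof.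
move=> WQ n; rewrite /local_ratio big_seq [RHS]big_seq.
by apply: eq_bigr => p /WQ pQ; rewrite modn_dvdm.
Qed.

Lemma local_ratio_itv W n : 0 <= local_ratio W n <= 1.
Proof.
rewrite /local_ratio big_seq.
apply: (big_ind (fun x : R => 0 <= x <= 1)) => [|x y|p]; first by rewrite ler01 lexx.
  by move=> /andP[x0 x1] /andP[y0 y1]; rewrite mulr_ge0 // mulr_ile1.
rewrite mem_primes => /andP[p_pr _]; have p_gt0 := prime_gt0 p_pr.
set t : R := _ / _; have : 0 <= t <= 1.
  rewrite /t divr_ge0 ?ler0n //= ler_pdivrMr ?ltr0n // mul1r ler_nat.
  by apply: leq_trans p_gt0; apply: leq_b1.
by lra.
Qed.

(** With W = n - 1 one gets the totient ratio itself; with W = Z! one gets a finite Euler product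
    that is periodic in n. Both choices are used. *)
Lemma local_ratio_pred n : (1 < n)%N -> local_ratio n.-1 n = totient_ratio n.-1.
Proof.
move=> n_gt1; rewrite totient_ratioE ?/local_ratio; last by lia.
rewrite big_seq [RHS]big_seq; apply: eq_bigr => p.
rewrite mem_primes dvdn_mod1 ?(ltnW n_gt1) // => /and3P[_ _ ->].
by rewrite mul1r.
Qed.

Lemma local_ratio_sum W n : (0 < W)%N ->
  local_ratio W n
  = \sum_(1 <= k < W.+1 | (k %| W)%N) mobius_over k * (n == 1 %[mod k])%N%:R.
Proof.
(* Congruence to 1 means divisibility of [n.-1] only for positive n; periodicity replaces n = 0 by n
   = W. *)
move=> W_gt0; wlog n_gt0 : n / (0 < n)%N => [hwlog|].
  case: n => [|n]; last exact: hwlog.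
  have -> : local_ratio W 0 = local_ratio W W.
    rewrite -[RHS](@local_ratio_periodic W W) ?modnn // => p.
    by rewrite mem_primes => /and3P[].
  rewrite hwlog //; apply: eq_bigr => k kW.
  by rewrite mod0n (eqP kW).
rewrite -sum_divisors //.
have g_gt0 : (0 < gcdn W n.-1)%N by rewrite gcdn_gt0 W_gt0.
transitivity (\prod_(p <- primes (gcdn W n.-1)) (1 - p%:R^-1) : R).
  rewrite /local_ratio (bigID (fun p => p %| n.-1)%N) /= mulrC.
  rewrite big_seq_cond big1 ?mul1r; last first.
    move=> p /andP[_ p_n]; by rewrite dvdn_mod1 // (negPf p_n) mul0r subr0.
  rewrite -big_filter.
  rewrite (_ : \prod_(p <- primes (gcdn W n.-1)) (1 - p%:R^-1) =
    \prod_(p <- [seq p <- primes W | (p %| n.-1)%N]) (1 - p%:R^-1 : R)); last first.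
    apply: perm_big; apply: uniq_perm; rewrite ?filter_uniq ?primes_uniq //.
    move=> p; rewrite mem_filter !mem_primes g_gt0 W_gt0 dvdn_gcd /=.
    by case: prime => //=; rewrite ?andbF // andbC.
  rewrite !big_filter; apply: eq_bigr => p p_n.
  by rewrite dvdn_mod1 // p_n mul1r.
rewrite -sum_mobius_over //.
rewrite [RHS](eq_bigr (fun k => if (k %| n.-1)%N then mobius_over k else 0)); last first.
  by move=> k _; rewrite dvdn_mod1 //; case: ifP; rewrite ?mulr1 ?mulr0.
rewrite -[RHS]big_mkcond -[RHS]big_filter; apply: perm_big.
apply: uniq_perm; rewrite ?filter_uniq ?divisors_uniq //.
by move=> k; rewrite mem_filter -!dvdn_divisors // dvdn_gcd andbC.
Qed.

Definition trunc_ratio y n : R :=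
  \sum_(1 <= k < y.+1) mobius_over k * (n == 1 %[mod k])%N%:R.

(** Crude, from |mu(k)/k| <= 1. This is the factor that the higher cut-off of the second sum has to
    compensate. *)
Lemma normr_trunc_ratio y n : `|trunc_ratio y n| <= y%:R.
Proof.
apply: le_trans (ler_norm_sum _ _ _) _.
apply: (@le_trans _ _ (\sum_(1 <= k < y.+1) 1)); last first.
  by rewrite sumr_const_nat subn1.
rewrite big_seq [leRHS]big_seq; apply: ler_sum => k.
rewrite mem_index_iota => /andP[k_gt0 _]; rewrite normrM.
apply: mulr_ile1; rewrite ?normr_ge0 ?mobius_over_le1 //.
by rewrite normr_nat lern1 leq_b1.
Qed.

(** Under the hypothesis on k the truncated sum is the part k <= y of the divisor sum of
    [local_ratio W n], and the tail remains. The hypothesis holds for W = n - 1, and for W = Z! with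
    y <= Z. *)
Lemma trunc_ratio_error W y n : (0 < W)%N ->
  (forall k, (0 < k <= y)%N -> (n == 1 %[mod k])%N -> (k %| W)%N) ->
  `|local_ratio W n - trunc_ratio y n|
  <= \sum_(y.+1 <= k < W.+1 | (k %| W)%N) k%:R^-1 * (n == 1 %[mod k])%N%:R.
Proof.
move=> W_gt0 yW; rewrite local_ratio_sum // /trunc_ratio.
pose G k : R := mobius_over k * (n == 1 %[mod k])%N%:R.
have -> : \sum_(1 <= k < W.+1 | (k %| W)%N) G k - \sum_(1 <= k < y.+1) G k
     = \sum_(y.+1 <= k < W.+1 | (k %| W)%N) G k.
  have -> : \sum_(1 <= k < y.+1) G k = \sum_(1 <= k < y.+1 | (k %| W)%N) G k.
    rewrite [RHS]big_mkcond big_seq [RHS]big_seq; apply: eq_bigr => k.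
    rewrite mem_index_iota ltnS => ky; case: ifPn => // kW; rewrite /G.
    case: eqP => [/eqP nk|_]; last by rewrite mulr0.
    by rewrite (yW k ky nk) in kW.
  have [yW'|Wy] := leqP y W.
    by rewrite (@big_cat_nat _ _ _ y.+1 1 W.+1) //= addrAC subrr add0r.
  rewrite [in X in _ - X](@big_cat_nat _ _ _ W.+1 1 y.+1) //=; last by rewrite ltnS ltnW.
  rewrite opprD addNKr [RHS]big_geq; last by rewrite ltnS ltnW.
  rewrite big_seq_cond big1 ?oppr0 // => k.
  rewrite mem_index_iota => /andP[/andP[kW _]] /(dvdn_leq W_gt0).
  by rewrite leqNgt kW.
apply: le_trans (ler_norm_sum _ _ _) _.
rewrite big_seq_cond [leRHS]big_seq_cond; apply: ler_sum => k.
rewrite mem_index_iota => /andP[/andP[yk _] _].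
rewrite normrM normr_nat ler_wpM2r ?ler0n // normr_mobius_over //.
exact: leq_ltn_trans yk.
Qed.

(** The differences of [G] telescope, and the last value of [G] is dropped by its sign. *)
Lemma sum_tail_le (F G : nat -> R) y N : (forall k, 0 <= G k) ->
  (forall k, (y <= k)%N -> F k.+1 <= G k - G k.+1) ->
  \sum_(y.+1 <= k < N) F k <= G y.
Proof.
move=> G_ge0 FG; have [Ny|yN] := leqP N y.+1; first by rewrite big_geq.
have -> : N = (y.+1 + (N - y.+1))%N by lia.
suff : forall m, \sum_(y.+1 <= k < y.+1 + m) F k <= G y - G (y + m)%N.
  by move=> /(_ (N - y.+1)%N) /le_trans; apply; rewrite lerBlDr lerDl.
elim=> [|m IH]; first by rewrite big_geq ?addn0 ?subrr.
rewrite addnS big_nat_recr ?leq_addr //= addSn.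
have := FG (y + m)%N (leq_addr _ _); move: IH; rewrite addnS addSn; lra.
Qed.

Lemma sum_tail_sqr y N : (0 < y)%N ->
  \sum_(y.+1 <= k < N) k%:R^-1 * k%:R^-1 <= y%:R^-1 :> R.
Proof.
move=> y_gt0; apply: (@sum_tail_le _ (fun k => k%:R^-1)) => [k|k yk].
- by rewrite invr_ge0.
have k0 : 0 < k%:R :> R by rewrite ltr0n (leq_trans y_gt0).
have k1 : 0 < k.+1%:R :> R by rewrite ltr0n.
rewrite -invfM -[leRHS](_ : (k%:R * k.+1%:R)^-1 = _).
  by rewrite lef_pV2 ?posrE ?mulr_gt0 // ler_wpM2r ?ler_nat // ltW.
rewrite -natr1; field; rewrite natr1 !lt0r_neq0 //.
Qed.

(** Telescoping against 2/sqrt t, whose derivative is -t^(-3/2). *)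
Lemma sum_tail_sqrt y N : (0 < y)%N ->
  \sum_(y.+1 <= k < N) (k%:R * Num.sqrt k%:R)^-1 <= 2 / Num.sqrt y%:R :> R.
Proof.
move=> y_gt0; apply: (@sum_tail_le _ (fun k => 2 / Num.sqrt k%:R)) => [k|k yk].
- by rewrite divr_ge0 ?sqrtr_ge0.
have k0 : 0 < k%:R :> R by rewrite ltr0n (leq_trans y_gt0).
have k1 : 0 < k.+1%:R :> R by rewrite ltr0n.
set a := Num.sqrt k%:R; set b := Num.sqrt k.+1%:R.
have a_gt0 : 0 < a by rewrite sqrtr_gt0.
have b_gt0 : 0 < b by rewrite sqrtr_gt0.
have a2 : a ^+ 2 = k%:R by rewrite sqr_sqrtr // ltW.
have b2 : b ^+ 2 = k.+1%:R by rewrite sqr_sqrtr // ltW.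
have ab : a <= b by rewrite ler_sqrt ?ler_nat // ltW.
have ba : b ^+ 2 - a ^+ 2 = 1 by rewrite a2 b2 -natr1; ring.
rewrite -b2 -subr_ge0.
rewrite [X in 0 <= X](_ : _ = (2 * b ^+ 2 * (b - a) - a) / (a * b ^+ 3)); last first.
  by field; rewrite !lt0r_neq0.
rewrite divr_ge0 //; last by rewrite mulr_ge0 ?exprn_ge0 // ltW.
(* (b - a)(b + a) = 1 and b + a <= 2 b *)
have h1 : 1 <= 2 * b * (b - a) by nra.
nra.
Qed.

Lemma sum_dvdn k N : (0 < k)%N ->
  (\sum_(1 <= m < N.+1) (k %| m) = N %/ k)%N.
Proof.
move=> k_gt0; elim: N => [|N IH]; first by rewrite big_geq ?div0n.
by rewrite big_nat_recr //= IH divnS // addnC.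
Qed.

(** After exchanging the sums, a given k > y divides n - 1 for at most N/k of the n, and N/k^2
    summed over k > y is at most N/y. The list is arbitrary so as to cover both the p and the p +
    d. *)
Lemma sum_totient_error (s : seq nat) y N : (0 < y)%N -> uniq s ->
  {in s, forall n, 1 < n <= N}%N ->
  \sum_(n <- s) `|totient_ratio n.-1 - trunc_ratio y n| <= N%:R / y%:R.
Proof.
move=> y_gt0 s_uniq sN.
apply: (@le_trans _ _ (\sum_(n <- s) \sum_(y.+1 <= k < N.+1)
    k%:R^-1 * (k %| n.-1)%N%:R)).
  rewrite big_seq [leRHS]big_seq; apply: ler_sum => n /sN /andP[n_gt1 nN].
  rewrite -local_ratio_pred //; apply: le_trans (trunc_ratio_error _ _) _.
  - by lia.
  - by move=> k _; rewrite dvdn_mod1 //; lia.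
  rewrite prednK; last by lia.
  have [ny|yn] := leqP n y.+1.
    rewrite big_geq //; by apply: sumr_ge0 => k _; rewrite mulr_ge0 ?invr_ge0.
  rewrite [leRHS](@big_cat_nat _ _ _ n) //=; [|exact: ltnW|exact: leqW].
  rewrite -[leLHS]addr0 lerD //; last first.
    by apply: sumr_ge0 => k _; rewrite mulr_ge0 ?invr_ge0.
  rewrite big_mkcond /=; apply: ler_sum => k _.
  case: ifP => kn; last by rewrite mulr_ge0 ?invr_ge0.
  by rewrite dvdn_mod1 ?kn //; lia.
rewrite exchange_big /=.
apply: (@le_trans _ _ (\sum_(y.+1 <= k < N.+1) N%:R * (k%:R^-1 * k%:R^-1))); last first.
  by rewrite -mulr_sumr ler_wpM2l // sum_tail_sqr.
rewrite big_seq [leRHS]big_seq; apply: ler_sum => k.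
rewrite mem_index_iota => /andP[yk _]; have k_gt0 : (0 < k)%N by lia.
rewrite -mulr_sumr [N%:R * _]mulrC -mulrA ler_wpM2l ?invr_ge0 //.
rewrite -natr_sum mulrC.
rewrite ler_pdivlMr ?ltr0n // -natrM ler_nat.
apply: (@leq_trans ((N %/ k) * k)); last exact: leq_trunc_div.
rewrite leq_mul2r -sum_dvdn //; apply/orP; right.
rewrite -(big_map predn xpredT (fun m => (k %| m) : nat)).
have sub : {subset map predn s <= index_iota 1 N.+1}.
  move=> m /mapP[n /sN nN ->]; rewrite mem_index_iota; lia.
have uniq_s : uniq (map predn s).
  rewrite map_inj_in_uniq // => a b /sN aN /sN bN; lia.
(* The numbers n - 1 are distinct elements of 1..N, so their sum is part of the sum over all of
   1..N. *)
rewrite [leqRHS](bigID (mem (map predn s))) /= -[in leqRHS]big_filter.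
have -> : (\sum_(i <- [seq i <- index_iota 1 N.+1 | i \in map predn s]) (k %| i)
    = \sum_(i <- map predn s) (k %| i))%N; last exact: leq_addr.
apply: perm_big; apply: uniq_perm; rewrite ?filter_uniq ?iota_uniq // => m.
by rewrite mem_filter; apply/andP/idP => [[]//|ms]; split; [|apply: sub].
Qed.

Lemma admsum_mod1_le d k (e : nat) : (0 < k)%N ->
  admsum d k (fun a => (a + e == 1 %[mod k])%N%:R : R) <= 1.
Proof.
move=> k_gt0; rewrite admsumE.
apply: (@le_trans _ _ (\sum_(0 <= a < k) (a + e == 1 %[mod k])%N%:R)).
  apply: ler_sum => a _; case: adm; rewrite ?mul1r ?mul0r //.
rewrite (@sum_shift _ k e (fun a => (a == 1 %[mod k])%N%:R)); last first.
  by move=> a; rewrite modn_mod.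
rewrite (bigD1_seq (1 %% k)%N) ?iota_uniq //=; last first.
  by rewrite mem_index_iota ltn_pmod.
rewrite modn_mod eqxx big_seq_cond big1 ?addr0 // => a.
rewrite mem_index_iota => /andP[/andP[_ a_k] ab].
by rewrite (modn_small a_k) (negPf ab).
Qed.

(** Computed at the modulus [k], where at most one of the phi_d(k) admissible classes satisfies the
    congruence. The shift [e] will be 0 for p and [d] for p + d. *)
Lemma admavg_mod1_le d k Q (e : nat) : ~~ odd d -> (0 < Q)%N -> (0 < k)%N ->
  (k %| Q)%N ->
  admavg d Q (fun a => (a + e == 1 %[mod k])%N%:R : R)
  <= Num.sqrt 6 / Num.sqrt k%:R.
Proof.
move=> d_even Q_gt0 k_gt0 kQ.
rewrite (@admavg_dvd _ d k) //; last by move=> a; rewrite modnDml.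
have c1 : 1 <= admcount R d k by apply: admcount_ge1.
have c0 : 0 < admcount R d k by apply: lt_le_trans c1.
have sk : 0 < Num.sqrt k%:R :> R by rewrite sqrtr_gt0 ltr0n.
rewrite /admavg ler_pdivrMr // -mulrAC ler_pdivlMr //.
apply: (@le_trans _ _ (1 * Num.sqrt k%:R)).
  by rewrite ler_wpM2r ?admsum_mod1_le // ltW.
rewrite mul1r -[X in _ <= X * _]/(Num.sqrt 6) -[admcount R d k]ger0_norm ?(ltW c0) //.
by rewrite -sqrtr_sqr -sqrtrM // ler_wsqrtr // admcount_sqr_ge6.
Qed.

(** The tail terms 1/k have average weight at most sqrt (6/k). The bound involves neither [Z] nor
    [Q], which lets [Z] grow while [y] is fixed. *)
Lemma admavg_trunc_error d Z Q y (e : nat) : ~~ odd d -> (0 < y <= Z)%N ->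
  (0 < Q)%N -> (Z`! %| Q)%N ->
  admavg d Q (fun n => `|local_ratio Z`! (n + e) - trunc_ratio y (n + e)|)
  <= 2 * Num.sqrt 6 / Num.sqrt y%:R.
Proof.
move=> d_even /andP[y_gt0 yZ] Q_gt0 ZQ.
apply: (@le_trans _ _ (admavg d Q (fun n =>
   \sum_(k <- [seq k <- index_iota y.+1 (Z`!).+1 | (k %| Z`!)%N])
     k%:R^-1 * (n + e == 1 %[mod k])%N%:R))).
  apply: admavg_le => // n; rewrite big_filter; apply: trunc_ratio_error.
    exact: fact_gt0.
  by move=> k /andP[k_gt0 ky] _; rewrite dvdn_fact // k_gt0 (leq_trans ky).
rewrite admavg_sum big_filter.
apply: (@le_trans _ _ (\sum_(y.+1 <= k < (Z`!).+1)
   Num.sqrt 6 * (k%:R * Num.sqrt k%:R)^-1)); last first.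
  rewrite -mulr_sumr [2 * _]mulrC -mulrA ler_wpM2l ?sqrtr_ge0 //.
  exact: sum_tail_sqrt.
rewrite big_mkcond big_seq [leRHS]big_seq; apply: ler_sum => k.
rewrite mem_index_iota => /andP[yk _]; have k_gt0 : (0 < k)%N by lia.
case: ifP => kZ; last by rewrite mulr_ge0 ?sqrtr_ge0 // invr_ge0 mulr_ge0 ?sqrtr_ge0.
rewrite invfM [leRHS]mulrCA ler_wpM2l ?invr_ge0 //.
by apply: admavg_mod1_le => //; apply: dvdn_trans ZQ.
Qed.

End TruncatedTotient.

(** * Local factors *)

Section EulerProduct.

Variable R : realType.
Implicit Types (d q m n p k y N W Z f : nat).

(** The factor at [p] of phi(n-1)/(n-1) times phi(n+d-1)/(n+d-1), with congruences in place of
    divisibility to keep it periodic. *)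
Definition pair_ratio d p n : R :=
  (1 - (n == 1 %[mod p])%N%:R / p%:R) * (1 - (n + d == 1 %[mod p])%N%:R / p%:R).

Lemma pair_ratio_periodic d p : mod_periodic p (pair_ratio d p).
Proof. by move=> n; rewrite /pair_ratio modn_mod modnDml. Qed.

Lemma local_ratio_pair d W n : local_ratio R W n * local_ratio R W (n + d)
  = \prod_(p <- primes W) pair_ratio d p n.
Proof. by rewrite /local_ratio -big_split. Qed.

Lemma admavgM d m n (f h : nat -> R) : (0 < m)%N -> (0 < n)%N -> coprime m n ->
  mod_periodic m f -> mod_periodic n h ->
  admavg d (m * n) (fun a => f a * h a) = admavg d m f * admavg d n h.
Proof.
by move=> m0 n0 mn fP hP; rewrite /admavg admsumM // admcountM // -mulf_div.
Qed.

Lemma admavg_prod d q (f : nat -> R) (F : nat -> nat -> R) (s : seq nat) :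
  (0 < q)%N -> all prime s -> uniq s -> all (coprime q) s -> mod_periodic q f ->
  (forall p, mod_periodic p (F p)) ->
  admavg d (q * \prod_(p <- s) p) (fun n => f n * \prod_(p <- s) F p n)
  = admavg d q f * \prod_(p <- s) admavg d p (F p).
Proof.
move=> + + + + + FP; elim: s q f => [|p s IH] q f q_gt0 /=.
  move=> _ _ _ fP; rewrite !big_nil muln1 mulr1; congr (_ / _).
  by apply: eq_admsum => a _; rewrite big_nil mulr1.
case/andP=> p_pr s_pr /andP[p_s s_uniq] /andP[q_p q_s] fP.
have p_gt0 := prime_gt0 p_pr.
rewrite !big_cons mulnA mulrA -admavgM // -IH ?muln_gt0 ?q_gt0 //.
- by congr (_ / _); apply: eq_admsum => a _; rewrite big_cons mulrA.
- apply/allP => r r_s; rewrite coprimeMl (allP q_s) //= prime_coprime //.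
  rewrite dvdn_prime2 //; last exact: (allP s_pr).
  by apply: contraNneq p_s => ->.
- apply: (periodic_map2 *%R); first by apply: periodic_dvdn fP; rewrite dvdn_mulr.
  by apply: periodic_dvdn (FP p); rewrite dvdn_mull.
Qed.

(** The branches are the factors of the three products in [Cconst]. For even [d] the prime 2 falls
    under the first one and gives 1 + 1/4 - 1 = 1/4. *)
Definition euler_factor d p : R :=
  if (p %| d)%N then 1 + (p%:R ^+ 2 * (p%:R - 1))^-1 - 2 / (p%:R * (p%:R - 1))
  else if (p %| d.+1)%N || (p %| d.-1)%N then 1 - (p%:R * (p%:R - 2))^-1
  else 1 - 2 / (p%:R * (p%:R - 2)).

(** Expanding the product leaves three counts: the class 1, admissible unless p divides d + 1; the
    class 1 - d, admissible unless p divides d - 1; and their intersection, nonempty only if p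
    divides d. *)
Lemma admavg_pair_ratio d p : (0 < d)%N -> ~~ odd d -> prime p -> odd p ->
  admavg d p (pair_ratio d p) = euler_factor d p.
Proof.
move=> d_gt0 d_even p_pr p_odd; have p_gt0 := prime_gt0 p_pr.
have p_gt2 : (2 < p)%N by apply: odd_prime_gt2.
have p3 : 3 <= p%:R :> R by rewrite ler_nat.
have cop a : coprime a p = ~~ (p %| a)%N by rewrite coprime_sym prime_coprime.
have cop1 : coprime 1 p := coprime1n p.
(* A natural number congruent to 1 - d modulo p. *)
pose b := (1 + (p - 1) * d)%N.
have bd : (b + d = 1 %[mod p])%N.
  rewrite /b -addnA -mulSnr subn1 prednK //.
  by rewrite addnC mulnC modnMDl.
have shiftE a : (a + d == 1 %[mod p])%N = (a == b %[mod p])%N.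
  by rewrite -bd eqn_modDr.
have s1 : admsum d p (fun a => (a == 1 %[mod p])%N%:R) = (~~ (p %| d.+1)%N)%:R :> R.
  have := @admsum_mod1 R d p (fun=> 1) 1 p_gt0 (fun _ => erefl).
  rewrite mulr1 /adm cop1 cop add1n => <-.
  by apply: eq_admsum => a _; rewrite mulr1.
have s2 : admsum d p (fun a => (a + d == 1 %[mod p])%N%:R) = (~~ (p %| d.-1)%N)%:R :> R.
  have := @admsum_mod1 R d p (fun=> 1) b p_gt0 (fun _ => erefl).
  rewrite mulr1 /adm -[coprime (b + d) p]coprime_modl bd coprime_modl cop1 andbT cop.
  have -> : (p %| b)%N = (p %| d.-1)%N.
    apply: dvdn_add_eq; rewrite /b.
    have -> : (1 + (p - 1) * d + d.-1 = d * p)%N.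
      by case: (d) (p) d_gt0 p_gt0 => // d' [] // p' _ _; nia.
    exact: dvdn_mull.
  by move=> <-; apply: eq_admsum => a _; rewrite mulr1 shiftE.
have dvd1 : (1 + d == 1 %[mod p])%N = (p %| d)%N.
  by rewrite eqn_mod_dvd ?leq_addr // addKn.
have s3 : admsum d p (fun a => (a == 1 %[mod p])%N%:R * (a + d == 1 %[mod p])%N%:R)
    = ((p %| d)%N && ~~ (p %| d.+1)%N)%:R :> R.
  rewrite admsum_mod1 //; last by move=> a; rewrite modnDml.
  by rewrite /adm cop1 cop add1n -natrM mulnb dvd1 andbC.
have -> : admavg d p (pair_ratio d p) = (admcount R d p - (~~ (p %| d.+1)%N)%:R / p%:R
   - (~~ (p %| d.-1)%N)%:R / p%:R
   + ((p %| d)%N && ~~ (p %| d.+1)%N)%:R / p%:R ^+ 2) / admcount R d p.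
  congr (_ / _); rewrite -s1 -s2 -s3 /admcount /admsum !mulr_suml -!sumrB -big_split.
  by apply: eq_bigr => a _; rewrite /pair_ratio /=; field; rewrite pnatr_eq0; lia.
rewrite /euler_factor admcount_prime //; case: ifP => pd.
  have -> : (p %| d.+1)%N = false.
    by rewrite -addn1 dvdn_addr // dvdn1; apply: gtn_eqF; lia.
  have -> : (p %| d.-1)%N = false.
    apply/negP => pd1; have : (p %| d.-1 + 1)%N by rewrite addn1 prednK.
    by rewrite dvdn_addr // dvdn1; apply/negP; rewrite gtn_eqF //; lia.
  by rewrite /=; field; rewrite !lt0r_neq0 //; lra.
have not_both : (p %| d.+1)%N -> (p %| d.-1)%N = false.
  move=> pd1; apply/negP => pd2; have : (p %| d.-1 + 2)%N by rewrite addn2 prednK.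
  by rewrite dvdn_addr // => /dvdn_leq; lia.
case: (p %| d.+1)%N not_both => /= [->//|_] /=.
  by field; rewrite !lt0r_neq0 //; lra.
by case: (p %| d.-1)%N => /=; field; rewrite !lt0r_neq0 //; lra.
Qed.

Lemma pair_ratio2 d n : ~~ odd d -> odd n -> pair_ratio d 2 n = 4^-1.
Proof.
move=> d_even n_odd; rewrite /pair_ratio !modn2 oddD n_odd (negPf d_even) /=.
by field.
Qed.

Lemma prod_primes_gcdn x f (P : pred nat) (F : nat -> R) : (0 < f)%N ->
  \prod_(p <- primes (gcdn x f) | P p) F p
  = \prod_(p <- primes f) (if P p && (p %| x)%N then F p else 1).
Proof.
move=> f_gt0; rewrite -big_mkcond -big_filter -[RHS]big_filter.
apply: perm_big; apply: uniq_perm; rewrite ?filter_uniq ?primes_uniq //.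
move=> p; rewrite !mem_filter !mem_primes f_gt0 gcdn_gt0 f_gt0 orbT dvdn_gcd.
by case: (P p); case: prime; case: (p %| x)%N.
Qed.

(** If p divides [d], the two congruences in [pair_ratio] are equivalent and give (1 - 1/p)^2, the
    factor of the first product. Otherwise they exclude each other, and each accounts for one of the
    other two products. *)
Lemma Kconst_pair_ratio d f a : (0 < a)%N -> (0 < f)%N ->
  Kconst d f a = \prod_(p <- primes f) pair_ratio d p a.
Proof.
move=> a_gt0 f_gt0; rewrite /Kconst !prod_primes_gcdn // -!big_split /=.
rewrite big_seq [RHS]big_seq; apply: eq_bigr => p.
rewrite mem_primes => /andP[p_pr _].
have p_neq0 : p%:R != 0 :> R by rewrite pnatr_eq0 -lt0n prime_gt0.
rewrite /pair_ratio !dvdn_mod1 //; last by rewrite addn_gt0 a_gt0.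
have [pd|pd] := boolP (p %| d)%N; last first.
  by case: (p %| a.-1)%N; case: (p %| (a + d).-1)%N => /=; field.
have -> : (a + d).-1 = (a.-1 + d)%N by lia.
by rewrite dvdn_addl //; case: (p %| a.-1)%N => /=; field.
Qed.

Lemma legendre_nat_periodic p : mod_periodic p (fun n => legendre n p).
Proof. by move=> n; apply: eq_legendre; rewrite -modz_nat modz_mod. Qed.

Lemma jacobi_periodic m : mod_periodic m (fun n => jacobi n m).
Proof.
move=> n; rewrite /jacobi big_seq [RHS]big_seq; apply: eq_bigr => p.
rewrite mem_primes => /and3P[_ _ pm]; congr (_ ^+ _).
by rewrite -legendre_nat_periodic modn_dvdm // legendre_nat_periodic.
Qed.

Lemma jacobi_val n m : (0 < m)%N -> coprime n m ->
  jacobi n m = 1 \/ jacobi n m = -1.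
Proof.
move=> m_gt0 nm; rewrite /jacobi big_seq.
apply: (big_ind (fun x : int => x = 1 \/ x = -1)) => [|x y|p]; first by left.
  by case=> ->; case=> ->; [left|right|right|left].
rewrite mem_primes => /and3P[p_pr _ pm].
have : legendre n p != 0.
  rewrite legendre_eq0 dvdzE /=; apply: contraTN nm => pn.
  rewrite /coprime; apply/eqP => g1; have : (p %| gcdn n m)%N by rewrite dvdn_gcd pn.
  by rewrite g1 dvdn1 => /eqP p1; rewrite p1 in p_pr.
case: (legendre_val n p) => -> // _; first by left; rewrite expr1n.
by rewrite -signr_odd; case: odd; [right|left].
Qed.

Lemma jacobi_coprime n m : (0 < m)%N -> jacobi n m != 0 -> coprime n m.
Proof.
move=> m_gt0; apply: contraNT => nm.
have g_gt1 : (1 < gcdn n m)%N.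
  by rewrite ltn_neqAle eq_sym -/(coprime n m) nm gcdn_gt0 m_gt0 orbT.
have p_pr := pdiv_prime g_gt1; set p := pdiv _ in p_pr.
have : (p %| gcdn n m)%N by apply: pdiv_dvd.
rewrite dvdn_gcd => /andP[pn pm].
have p_m : p \in primes m by rewrite mem_primes p_pr m_gt0.
rewrite /jacobi (bigD1_seq p) ?primes_uniq //=.
have /eqP -> : legendre n p == 0 by rewrite legendre_eq0 dvdzE.
by rewrite expr0n -leqn0 leqNgt logn_gt0 p_m mul0r.
Qed.

(** A nonzero Jacobi symbol forces coprimality, so the members of [Phiset] are admissible.
    Periodicity replaces the representative [gtilde g0] by 0. *)
Lemma Omega_admsum d (g0 e1 e2 : int) : (0 < gtilde g0)%N -> e1 != 0 -> e2 != 0 ->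
  Omega d g0 e1 e2 = admsum d (gtilde g0) (fun n =>
    \prod_(p <- primes (gtilde g0)) pair_ratio d p n
    * ((jacobi n (gtilde g0) == e1) && (jacobi (n + d)%N (gtilde g0) == e2))%:R) :> R.
Proof.
set m := gtilde g0 => m_gt0 e1_neq0 e2_neq0.
rewrite /Omega /Phiset -/m big_filter admsumE -sum_iota1; last first.
  move=> n; rewrite adm_periodic; congr (_ * (_ * _)).
    rewrite big_seq [RHS]big_seq; apply: eq_bigr => p; rewrite mem_primes => /and3P[_ _ pm].
    by rewrite -pair_ratio_periodic modn_dvdm // pair_ratio_periodic.
  rewrite jacobi_periodic; congr (_ && (_ == _))%:R.
  by rewrite -[LHS]jacobi_periodic modnDml jacobi_periodic.
rewrite big_mkcond big_seq [RHS]big_seq; apply: eq_bigr => a.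
rewrite mem_iota => /andP[a_gt0 _].
case: ifPn => [/andP[/eqP j1 /eqP j2]|_]; last by rewrite !mulr0.
rewrite mulr1 Kconst_pair_ratio //.
by rewrite /adm !jacobi_coprime ?mul1r // ?j1 ?j2.
Qed.

(** The minus signs come from [Delta_per]: the product of [chi_sym] and a Jacobi symbol equal to e1
    is -1 exactly when [chi_sym] is - e1. The list holds the classes prime to 8. *)
Definition sign_count (e t : bool) d (e1 e2 : int) : nat :=
  count (fun n => (chi_sym e t n == - e1) && (chi_sym e t (n + d) == - e2))
    [:: 1; 3; 5; 7]%N.

Lemma chi_sym_periodic e t : mod_periodic 8 (chi_sym e t).
Proof.
move=> n; rewrite /chi_sym /chi8 /chi4 modn_mod modn_dvdm //.
Qed.

Lemma chi_sym_val e t n : chi_sym e t n = 1 \/ chi_sym e t n = -1.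
Proof.
by rewrite /chi_sym /chi8 /chi4; case: e; case: t => /=; do ?case: ifP => _; auto.
Qed.

Lemma adm8 d n : ~~ odd d -> adm d 8 n = odd n.
Proof.
move=> d_even; rewrite /adm -[8%N]/(2 ^ 3)%N !coprime_pexpr // !coprimen2 oddD.
by rewrite (negPf d_even) addbF andbb.
Qed.

Lemma admsum8 d (f : nat -> R) : ~~ odd d ->
  admsum d 8 f = \sum_(n <- [:: 1; 3; 5; 7]%N) f n.
Proof.
move=> d_even; rewrite /admsum (eq_bigl odd) => [|n]; last exact: adm8.
by rewrite -big_filter.
Qed.

Lemma admsum_sign_count e t d (e1 e2 : int) : ~~ odd d ->
  admsum d 8 (fun n => ((chi_sym e t n == - e1) && (chi_sym e t (n + d) == - e2))%:R)
  = (sign_count e t d e1 e2)%:R :> R.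
Proof.
move=> d_even; rewrite admsum8 // /sign_count -sum1_count natr_sum [RHS]big_mkcond.
by apply: eq_bigr => n _; case: ifP.
Qed.

Lemma admcount8 d : ~~ odd d -> admcount R d 8 = 4.
Proof.
by move=> d_even; rewrite /admcount admsum8 // !big_cons big_nil; lra.
Qed.

Lemma sign_count_mod e t d e1 e2 : sign_count e t d e1 e2 = sign_count e t (d %% 8) e1 e2.
Proof.
apply: eq_count => n; congr (_ && (_ == _)).
by rewrite -chi_sym_periodic -[RHS]chi_sym_periodic modnDmr.
Qed.

(** This explains the case distinction in [Aconst]: the weight of each pair of signs is the
    proportion of the four odd classes modulo 8 that complete it to a solution. It is checked for
    each even residue of [d] modulo 8. *)
Lemma Aconst_sign_count d (g0 : int) : ~~ odd d -> squarefree g0 ->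
  Aconst d g0 = 4^-1 * (
    let c := sign_count (~~ odd `|g0|%N) (tsign g0) d in
    (c 1 1)%:R * Omega d g0 1 1 + (c 1 (-1))%:R * Omega d g0 1 (-1)
    + (c (-1) 1)%:R * Omega d g0 (-1) 1 + (c (-1) (-1))%:R * Omega d g0 (-1) (-1)) :> R.
Proof.
move=> d_even sf; rewrite /Aconst /=.
move: (Omega d g0 1 1) (Omega d g0 1 (-1)) (Omega d g0 (-1) 1) (Omega d g0 (-1) (-1)).
move=> W1 W2 W3 W4; rewrite !(sign_count_mod _ _ d).
have d8 : (d %% 8 \in [:: 0; 2; 4; 6])%N.
  have := ltn_pmod d (isT : 0 < 8)%N; have : ~~ odd (d %% 8) by lia.
  by case: (d %% 8)%N => [|[|[|[|[|[|[|[|]]]]]]]].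
have d4 : (d %% 4 = (d %% 8) %% 4)%N by rewrite modn_dvdm.
case: (boolP (odd _)) => g0_odd; first rewrite tsign_odd //.
  case: (boolP (g0 == 1 %[mod 4])%Z) => [_|_] /=.
    by rewrite /sign_count /=; lra.
  rewrite d4; move: d8; rewrite !inE => /or4P[]/eqP -> /=;
  rewrite /sign_count /=; lra.
move: (tsign g0) => t; move: d8; rewrite !inE => /or4P[]/eqP -> /=;
rewrite /sign_count; case: t => /=; lra.
Qed.

(** [Delta_per] mixes the moduli 8 and [gtilde g0]. Splitting by the values of the two Jacobi
    symbols writes it as a sum of four products X Y, with X depending on n modulo 8 and Y on n
    modulo [gtilde g0], and the Chinese remainder theorem applies to each. *)
Lemma admavg_sign_part d (g0 : int) : ~~ odd d -> squarefree g0 ->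
  admavg d (8 * gtilde g0) (fun n => pair_ratio d 2 n
    * (\prod_(p <- primes (gtilde g0)) pair_ratio d p n * (Delta_per d g0 n)%:R))
  = 4^-1 * (Aconst d g0 / (size (phiset d (gtilde g0)))%:R).
Proof.
move=> d_even sf; have m_odd := odd_gtilde sf; set m := gtilde g0 in m_odd *.
have m_gt0 : (0 < m)%N by case: (m) m_odd.
have m8 : coprime 8 m by rewrite (@coprimeXl 3 2 m) ?coprime2n.
rewrite size_phiset /admavg admcountM // admcount8 // Aconst_sign_count //=.
pose K n : R := \prod_(p <- primes m) pair_ratio d p n.
set ev := ~~ odd `|g0|; set t := tsign g0.
pose X (e1 e2 : int) n : R := ((chi_sym ev t n == - e1) && (chi_sym ev t (n + d) == - e2))%:R.
pose Y (e1 e2 : int) n : R := K n * ((jacobi n m == e1) && (jacobi (n + d)%N m == e2))%:R.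
have XP e1 e2 : mod_periodic 8 (X e1 e2).
  move=> n; rewrite /X chi_sym_periodic -[in chi_sym ev t (n %% 8 + d)]chi_sym_periodic.
  by rewrite modnDml chi_sym_periodic.
have YP e1 e2 : mod_periodic m (Y e1 e2).
  move=> n; congr (_ * _).
    rewrite /K big_seq [RHS]big_seq; apply: eq_bigr => p; rewrite mem_primes => /and3P[_ _ pm].
    by rewrite -pair_ratio_periodic modn_dvdm // pair_ratio_periodic.
  rewrite jacobi_periodic; congr (_ && (_ == _))%:R.
  by rewrite -[LHS]jacobi_periodic modnDml jacobi_periodic.
have -> : admsum d (8 * m) (fun n => pair_ratio d 2 n * (K n * (Delta_per d g0 n)%:R))
  = 4^-1 * (admsum d (8 * m) (fun n => X 1 1 n * Y 1 1 n)
          + admsum d (8 * m) (fun n => X 1 (-1) n * Y 1 (-1) n)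
          + admsum d (8 * m) (fun n => X (-1) 1 n * Y (-1) 1 n)
          + admsum d (8 * m) (fun n => X (-1) (-1) n * Y (-1) (-1) n)).
  rewrite /admsum -!big_split mulr_sumr; apply: eq_bigr => n.
  rewrite adm_mul adm8 // => /andP[n_odd /andP[nm ndm]].
  rewrite pair_ratio2 // /X /Y /Delta_per -/m -/ev -/t; congr (_ * _).
  case: (jacobi_val m_gt0 nm) => ->; case: (jacobi_val m_gt0 ndm) => ->;
  case: (chi_sym_val ev t n) => ->; case: (chi_sym_val ev t (n + d)) => -> /=; ring.
rewrite !admsumM // !admsum_sign_count //.
have c0 : admcount R d m != 0.
  by apply/lt0r_neq0/(lt_le_trans ltr01)/admcount_ge1.
rewrite -!Omega_admsum // ?oppr_eq0 //; field.
by rewrite c0.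
Qed.

End EulerProduct.

(** * The Euler product *)

Section DensityLimit.

Variable R : realType.
Implicit Types (d q m n p k y z N W Z f : nat).

Lemma eq_admavg d q (f h : nat -> R) : f =1 h -> admavg d q f = admavg d q h.
Proof. by move=> fh; congr (_ / _); apply: eq_admsum => a _. Qed.

Lemma ler_norm_mul_trunc (a b a' b' Y : R) (c : bool) : 0 <= b <= 1 -> `|a'| <= Y ->
  `|a * b * c%:R - a' * b' * c%:R| <= `|a - a'| + Y * `|b - b'|.
Proof.
case/andP=> b0 b1 a'Y; rewrite -mulrBl normrM.
apply: (@le_trans _ _ `|a * b - a' * b'|).
  by rewrite ler_piMr // normr_nat lern1; case: c.
have -> : a * b - a' * b' = (a - a') * b + a' * (b - b') by ring.
apply: le_trans (ler_normD _ _) _; rewrite !normrM; apply: lerD.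
  by rewrite ler_piMr // ger0_norm.
exact: ler_wpM2r.
Qed.

Lemma Delta_per_periodic d (g0 : int) : mod_periodic (8 * gtilde g0) (Delta_per d g0).
Proof.
have cP : mod_periodic (8 * gtilde g0) (fun n =>
    chi_sym (~~ odd `|g0|) (tsign g0) n * jacobi n (gtilde g0)).
  apply: (periodic_map2 *%R).
    by apply: periodic_dvdn (@chi_sym_periodic _ _); rewrite dvdn_mulr.
  by apply: periodic_dvdn (@jacobi_periodic _); rewrite dvdn_mull.
have cdP := periodic_shift d cP.
by move=> n; rewrite /Delta_per; have := cP n; have := cdP n => /= -> ->.
Qed.

Lemma prime_dvd_fact p Z : prime p -> (p %| Z`!)%N = (p <= Z)%N.
Proof.
move=> p_pr; apply/idP/idP => [|pZ]; last by rewrite dvdn_fact // prime_gt0.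
elim: Z => [|Z IH]; first by rewrite dvdn1 => /eqP p1; rewrite p1 in p_pr.
rewrite factS Euclid_dvdM // => /orP[/dvdn_leq->//|/IH/leqW//].
Qed.

Definition coprime_primes Z m : seq nat :=
  [seq p <- index_iota 0 Z.+1 | prime p && ~~ (p %| 2 * m)%N].

(** The primes up to [Z] are 2, the divisors of [gtilde g0] and the rest. The first two kinds are
    tied to [Delta_per] and averaged jointly with it; the rest are independent and split off one by
    one. *)
Lemma admavg_euler d (g0 : int) Z Q : (0 < d)%N -> ~~ odd d -> squarefree g0 ->
  (2 <= Z)%N -> (gtilde g0 <= Z)%N -> (0 < Q)%N ->
  (8 * gtilde g0 * \prod_(p <- coprime_primes Z (gtilde g0)) p %| Q)%N ->
  admavg d Q (fun n =>
    local_ratio R Z`! n * local_ratio R Z`! (n + d) * (Delta_per d g0 n)%:R)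
  = Aconst d g0 / (size (phiset d (gtilde g0)))%:R
    * \prod_(0 <= p < Z.+1 | prime p && ~~ (p %| gtilde g0)%N) euler_factor R d p.
Proof.
move=> d_gt0 d_even sf Z2 mZ Q_gt0; have m_odd := odd_gtilde sf.
set m := gtilde g0 in m_odd mZ *; set s := coprime_primes Z m => sQ.
have m_gt0 : (0 < m)%N by case: (m) m_odd.
have s_pr p : p \in s -> prime p by rewrite mem_filter => /andP[/andP[]].
have s_m p : p \in s -> ~~ (p %| 2 * m)%N by rewrite mem_filter => /andP[/andP[]].
have s_odd p : p \in s -> odd p.
  move=> ps; case: (even_prime (s_pr p ps)) => // p2.
  by have := s_m p ps; rewrite p2 dvdn_mulr.
have s_uniq : uniq s by rewrite filter_uniq // iota_uniq.
pose f n : R := pair_ratio R d 2 n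
    * (\prod_(p <- primes m) pair_ratio R d p n * (Delta_per d g0 n)%:R).
have fP : mod_periodic (8 * m) f.
  apply: (periodic_map2 *%R).
    by apply: periodic_dvdn (@pair_ratio_periodic R d 2); rewrite dvdn_mulr.
  apply: (periodic_map2 *%R).
    move=> n; rewrite big_seq [RHS]big_seq; apply: eq_bigr => p; rewrite mem_primes => /and3P[_ _ pm].
    by rewrite -pair_ratio_periodic modn_dvdm ?dvdn_mull // pair_ratio_periodic.
  by move=> n; rewrite Delta_per_periodic.
have -> : admavg d Q (fun n => local_ratio R Z`! n * local_ratio R Z`! (n + d)
     * (Delta_per d g0 n)%:R)
   = admavg d Q (fun n => f n * \prod_(p <- s) pair_ratio R d p n).
  apply: eq_admavg => n; rewrite local_ratio_pair.
  have -> : \prod_(p <- primes Z`!) pair_ratio R d p n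
     = \prod_(p <- 2 :: primes m ++ s) pair_ratio R d p n.
    apply: perm_big; apply: uniq_perm; first exact: primes_uniq.
      rewrite /= mem_cat negb_or cat_uniq primes_uniq s_uniq andbT /=.
      rewrite mem_primes dvdn2 m_odd !andbF /=; apply/andP; split.
        by apply/negP => /s_m; rewrite dvdn_mulr.
      apply/hasPn => p /s_m; apply: contra; rewrite mem_primes => /and3P[_ _ pm].
      by rewrite dvdn_mull.
    move=> p; rewrite mem_primes fact_gt0 /= inE mem_cat mem_filter mem_index_iota ltnS mem_primes.
    have [p_pr|] := boolP (prime p); last first.
      by move=> p_npr /=; rewrite orbF; apply/esym/negbTE; apply: contraNneq p_npr => ->.
    rewrite prime_dvd_fact // m_gt0 /= Euclid_dvdM // [(p %| 2)%N]dvdn_prime2 //.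
    have [->|_] := eqVneq p 2%N; first by rewrite Z2.
    have [pm|_] := boolP (p %| m)%N => //=.
    by apply: leq_trans mZ; apply: dvdn_leq.
  by rewrite big_cons big_cat /= /f; ring.
rewrite (@admavg_dvd R d (8 * m * \prod_(p <- s) p)) //; last first.
  apply: (periodic_map2 *%R); first by apply: periodic_dvdn fP; rewrite dvdn_mulr.
  move=> n; rewrite big_seq [RHS]big_seq; apply: eq_bigr => p ps.
  rewrite -pair_ratio_periodic modn_dvdm ?pair_ratio_periodic // dvdn_mull //.
  by rewrite (big_rem p) //= dvdn_mulr.
rewrite admavg_prod //; last 4 first.
- by rewrite muln_gt0.
- by apply/allP.
- apply/allP => p ps; rewrite coprime_sym prime_coprime ?s_pr //.
  apply: contra (s_m p ps); rewrite !Euclid_dvdM ?s_pr // => /orP[p8|->]; last by rewrite orbT.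
  by move: p8; rewrite -[8%N]/(2 ^ 3)%N Euclid_dvdX ?s_pr // => /andP[->].
- exact: pair_ratio_periodic.
rewrite admavg_sign_part //; set A : R := Aconst d g0 / _.
rewrite -[LHS]mulrA [LHS]mulrCA; congr (A * _).
(* The factor 1/4 left by [admavg_sign_part] is the Euler factor at 2. *)
have -> : \prod_(0 <= p < Z.+1 | prime p && ~~ (p %| m)%N) euler_factor R d p
   = \prod_(p <- 2 :: s) euler_factor R d p.
  rewrite -big_filter; apply: perm_big; apply: uniq_perm.
  - by rewrite filter_uniq // iota_uniq.
  - by rewrite /= s_uniq andbT; apply/negP => /s_m; rewrite dvdn_mulr.
  move=> p; rewrite inE !mem_filter !mem_index_iota !ltnS.
  have [p_pr|] := boolP (prime p); last first.
    by move=> p_npr /=; rewrite orbF; apply/esym/negbTE; apply: contraNneq p_npr => ->.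
  rewrite Euclid_dvdM // [(p %| 2)%N]dvdn_prime2 //=.
  have [->|_] //= := eqVneq p 2%N.
  by rewrite Z2 dvdn2 m_odd.
rewrite big_cons; congr (_ * _).
  by rewrite /euler_factor dvdn2 d_even; field.
rewrite big_seq [RHS]big_seq; apply: eq_bigr => p ps.
by apply: admavg_pair_ratio => //; [apply: s_pr|apply: s_odd].
Qed.

Definition generic_prime d f p := ~~ (p %| d * d.+1 * d.-1)%N && ~~ (p %| f)%N.

(** Among d - 1, d and d + 1 there are multiples of 2 and of 3. *)
Lemma generic_prime_ge5 d f p : ~~ odd d -> prime p -> generic_prime d f p ->
  (5 <= p)%N.
Proof.
move=> d_even p_pr /andP[pd _].
have : (2 %| d * d.+1 * d.-1)%N by rewrite -mulnA dvdn_mulr // dvdn2.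
have : (3 %| d * d.+1 * d.-1)%N.
  have [d0|[d1|d2]] : (d %% 3 = 0 \/ d %% 3 = 1 \/ d %% 3 = 2)%N by lia.
  - by rewrite -mulnA dvdn_mulr // /dvdn d0.
  - by rewrite dvdn_mull //; lia.
  - by rewrite dvdn_mulr // dvdn_mull //; lia.
by case: p p_pr pd => [|[|[|[|[|p]]]]] // _ /negPf ->.
Qed.

Lemma generic_factor_itv d f p : ~~ odd d -> prime p -> generic_prime d f p ->
  0 <= 1 - 2 / (p%:R * (p%:R - 2) : R) <= 1.
Proof.
move=> d_even p_pr /(generic_prime_ge5 d_even p_pr); rewrite -(ler_nat R) => p5.
have q_gt0 : 0 < p%:R * (p%:R - 2) :> R by nra.
rewrite subr_ge0 ler_pdivrMr // mul1r gerDl oppr_le0 divr_ge0 ?(ltW q_gt0) // andbT.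
by nra.
Qed.

(** All factors lie in [0, 1], so the partial products decrease and stay nonnegative: the [lim] in
    [prime_prod] is a genuine limit. *)
Lemma generic_prod_cvg d f : ~~ odd d ->
  (fun n => \prod_(0 <= p < n | prime p && generic_prime d f p)
     (1 - 2 / (p%:R * (p%:R - 2)) : R)) @ \oo
  --> prime_prod (generic_prime d f) (fun p => 1 - 2 / (p%:R * (p%:R - 2)) : R).
Proof.
move=> d_even; set T := fun n : nat => _.
have T_ge0 n : 0 <= T n.
  rewrite /T; apply: (big_ind (fun x : R => 0 <= x)) => // [x y|p /andP[p_pr gp]].
    exact: mulr_ge0.
  by have /andP[] := generic_factor_itv d_even p_pr gp.
apply: nonincreasing_is_cvgn; last by exists 0 => _ [n _ <-].
apply/nonincreasing_seqP => n; rewrite /T big_mkcond big_nat_recr //= -big_mkcond.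
rewrite -/(T n); case: ifP => [/andP[p_pr gp]|_]; last by rewrite mulr1.
by apply: ler_piMr => //; have /andP[] := generic_factor_itv d_even p_pr gp.
Qed.

Lemma euler_prod_split d f Z : (0 < d)%N -> ~~ odd d -> (d < Z)%N ->
  \prod_(0 <= p < Z.+1 | prime p && ~~ (p %| f)%N) euler_factor R d p
  = (\prod_(p <- primes d | ~~ (p %| f)%N)
      (1 + (p%:R ^+ 2 * (p%:R - 1))^-1 - 2 / (p%:R * (p%:R - 1))))
  * (\prod_(0 <= p < d.+2 |
        [&& prime p, (p %| d.+1)%N || (p %| d.-1)%N & ~~ (p %| f)%N])
      (1 - (p%:R * (p%:R - 2))^-1))
  * \prod_(0 <= p < Z.+1 | prime p && generic_prime d f p)
     (1 - 2 / (p%:R * (p%:R - 2))).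
Proof.
move=> d_gt0 d_even dZ.
(* This makes the three classes of primes disjoint. The bound d < Z ensures that the first two are
   complete below Z. *)
have coprime_succ p : prime p -> (p %| d)%N -> (p %| d.+1)%N || (p %| d.-1)%N = false.
  move=> p_pr pd; have := prime_gt1 p_pr => p_gt1.
  apply/negP => /orP[|pd1].
    by rewrite -addn1 dvdn_addr // dvdn1 gtn_eqF.
  have : (p %| d.-1 + 1)%N by rewrite addn1 prednK.
  by rewrite dvdn_addr // dvdn1 gtn_eqF.
rewrite (bigID (fun p => p %| d)%N) /= -mulrA; congr (_ * _).
  rewrite -big_filter -[RHS]big_filter; rewrite (perm_big [seq p <- primes d | ~~ (p %| f)%N]).
    rewrite big_seq [RHS]big_seq; apply: eq_bigr => p; rewrite mem_filter mem_primes.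
    by case/and4P=> _ _ _ pd; rewrite /euler_factor pd.
  apply: uniq_perm; rewrite ?filter_uniq ?primes_uniq ?iota_uniq //.
  move=> p; rewrite !mem_filter mem_primes mem_index_iota d_gt0 /= ltnS.
  have [pd|] := boolP (p %| d)%N; last by rewrite !andbF.
  by rewrite (leq_trans (dvdn_leq d_gt0 pd)) 1?ltnW // !andbT andbC.
rewrite (bigID (fun p => (p %| d.+1) || (p %| d.-1))%N) /=; congr (_ * _).
  rewrite -big_filter -[RHS]big_filter.
  rewrite (perm_big [seq p <- index_iota 0 d.+2 | [&& prime p, (p %| d.+1)%N || (p %| d.-1)%N & ~~ (p %| f)%N]]).
    rewrite big_seq [RHS]big_seq; apply: eq_bigr => p; rewrite mem_filter.
    case/andP=> /and3P[p_pr pd1 _] _; rewrite /euler_factor pd1.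
    by case: ifP => // pd; rewrite coprime_succ in pd1.
  apply: uniq_perm; rewrite ?filter_uniq ?iota_uniq //.
  move=> p; rewrite !mem_filter !mem_index_iota !ltnS /=.
  have [p_pr|] //= := boolP (prime p).
  have [pd1|] := boolP ((p %| d.+1) || (p %| d.-1))%N; last by rewrite !andbF.
  have -> : (p %| d)%N = false by apply: contraTF pd1 => pd; rewrite coprime_succ.
  have pd2 : (p <= d.+1)%N.
    case/orP: pd1 => [/dvdn_leq->//|/dvdn_leq].
    case: d d_gt0 d_even {dZ coprime_succ} => [|[|d]] // _ _ /(_ isT) /leq_trans; apply.
    by lia.
  by rewrite pd2 (leq_trans pd2 dZ) /= !andbT.
rewrite big_mkcond [RHS]big_mkcond; apply: eq_bigr => p _.
have [p_pr|] //= := boolP (prime p).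
rewrite /generic_prime !Euclid_dvdM // /euler_factor !negb_or.
case: (p %| d)%N => /=; first by rewrite andbF.
by case: (p %| d.+1)%N; case: (p %| d.-1)%N; rewrite /= ?andbF // andbT andbC.
Qed.

Lemma euler_prod_cvg d f (eps : R) : (0 < d)%N -> ~~ odd d -> 0 < eps ->
  exists Z0, forall Z, (Z0 <= Z)%N ->
    `|\prod_(0 <= p < Z.+1 | prime p && ~~ (p %| f)%N) euler_factor R d p
      - Cconst d f| <= eps.
Proof.
move=> d_gt0 d_even eps_gt0.
set c1 := \prod_(p <- primes d | ~~ (p %| f)%N)
      (1 + (p%:R ^+ 2 * (p%:R - 1))^-1 - 2 / (p%:R * (p%:R - 1))) : R.
set c2 := \prod_(0 <= p < d.+2 |
        [&& prime p, (p %| d.+1)%N || (p %| d.-1)%N & ~~ (p %| f)%N])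
      (1 - (p%:R * (p%:R - 2))^-1) : R.
have cv : (fun n => c1 * c2 * \prod_(0 <= p < n | prime p && generic_prime d f p)
     (1 - 2 / (p%:R * (p%:R - 2)))) @ \oo --> (Cconst d f : R).
  by apply: cvgMr; apply: generic_prod_cvg.
move/cvgrPdist_le: cv => /(_ _ eps_gt0)[N _ NP].
exists (maxn N d.+1) => Z; rewrite geq_max => /andP[NZ dZ].
rewrite euler_prod_split // distrC; apply: NP => /=.
exact: leqW.
Qed.

(** Each pair (k1, k2) is averaged at its own modulus, the one at which (H) is applied. Passing to a
    common modulus is left to [trunc_densityE]. *)
Definition trunc_density d (g0 : int) y z : R :=
  \sum_(1 <= k1 < y.+1) mobius_over R k1 * \sum_(1 <= k2 < z.+1) mobius_over R k2 *
    admavg d (8 * gtilde g0 * (k1 * k2)) (fun n =>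
      (n == 1 %[mod k1])%N%:R * (n + d == 1 %[mod k2])%N%:R * (Delta_per d g0 n)%:R).

Lemma trunc_term_periodic d (g0 : int) k1 k2 :
  mod_periodic (8 * gtilde g0 * (k1 * k2)) (fun n => (n == 1 %[mod k1])%N%:R
      * (n + d == 1 %[mod k2])%N%:R * (Delta_per d g0 n)%:R : R).
Proof.
have k1Q : (k1 %| 8 * gtilde g0 * (k1 * k2))%N by rewrite dvdn_mull ?dvdn_mulr.
have k2Q : (k2 %| 8 * gtilde g0 * (k1 * k2))%N by rewrite dvdn_mull ?dvdn_mull.
apply: (periodic_map2 *%R); first apply: (periodic_map2 *%R).
- by move=> n; rewrite modn_dvdm.
- by move=> n; rewrite -modnDml modn_dvdm ?modnDml.
by move=> n; rewrite (periodic_dvdn _ (@Delta_per_periodic d g0)) // dvdn_mulr.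
Qed.

Lemma trunc_densityE d (g0 : int) y z Z Q : ~~ odd d -> (0 < Q)%N ->
  (y <= Z)%N -> (z <= Z)%N -> (8 * gtilde g0 * (Z`! * Z`!) %| Q)%N ->
  trunc_density d g0 y z = admavg d Q (fun n =>
    trunc_ratio R y n * trunc_ratio R z (n + d) * (Delta_per d g0 n)%:R).
Proof.
move=> d_even Q_gt0 yZ zZ ZQ.
rewrite (@eq_admavg _ _ _ (fun n => \sum_(1 <= k1 < y.+1) mobius_over R k1 *
   \sum_(1 <= k2 < z.+1) mobius_over R k2 *
   ((n == 1 %[mod k1])%N%:R * (n + d == 1 %[mod k2])%N%:R * (Delta_per d g0 n)%:R))).
  rewrite admavg_sum /trunc_density !big_seq; apply: eq_bigr => k1.
  rewrite mem_index_iota ltnS => /andP[k1_gt0 k1y]; congr (_ * _).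
  rewrite admavg_sum !big_seq; apply: eq_bigr => k2.
  rewrite mem_index_iota ltnS => /andP[k2_gt0 k2z]; congr (_ * _).
  apply/esym/admavg_dvd => //; last exact: trunc_term_periodic.
  apply: dvdn_trans ZQ; rewrite dvdn_mul // dvdn_mul // dvdn_fact //.
    by rewrite k1_gt0 (leq_trans k1y).
  by rewrite k2_gt0 (leq_trans k2z).
move=> n; rewrite /trunc_ratio -mulrA mulr_suml; apply: eq_bigr => k1 _.
rewrite -!mulrA; congr (_ * _); rewrite mulr_suml mulr_sumr.
by apply: eq_bigr => k2 _; ring.
Qed.

(** With [y] and [z] fixed, a large Z brings the finite Euler product within any eps of the limit,
    while the truncation errors are bounded uniformly in Z; then eps is removed. *)
Lemma trunc_density_error d (g0 : int) y z : (0 < d)%N -> ~~ odd d ->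
  squarefree g0 -> (0 < y)%N -> (0 < z)%N ->
  `|trunc_density d g0 y z
    - Cconst d (gtilde g0) * Aconst d g0 / (size (phiset d (gtilde g0)))%:R|
  <= 2 * Num.sqrt 6 / Num.sqrt y%:R + y%:R * (2 * Num.sqrt 6 / Num.sqrt z%:R).
Proof.
move=> d_gt0 d_even sf y_gt0 z_gt0; set m := gtilde g0; set L : R := _ / _%:R.
have m_gt0 : (0 < m)%N by have := odd_gtilde sf; rewrite -/m; case: (m).
apply/ler_addgt0Pr => eps eps_gt0; set A : R := Aconst d g0 / (size (phiset d m))%:R.
have A1 : 0 < `|A| + 1 by rewrite ltr_wpDl.
have [Z0 Z0P] := euler_prod_cvg m d_gt0 d_even (divr_gt0 eps_gt0 A1).
pose Z := (maxn Z0 (maxn 2 (maxn m (maxn y z))))%N.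
have [Z0Z Z2 mZ yZ zZ] : [/\ Z0 <= Z, 2 <= Z, m <= Z, y <= Z & z <= Z]%N.
  by rewrite /Z; split; lia.
(* Z! Z! makes every modulus 8 m k1 k2 divide Q, and the product of primes gives the divisibility
   asked by [admavg_euler]. *)
pose Q := (8 * m * (Z`! * Z`!) * \prod_(p <- coprime_primes Z m) p)%N.
have P_gt0 : (0 < \prod_(p <- coprime_primes Z m) p)%N.
  rewrite big_seq; apply: prodn_cond_gt0 => p; rewrite mem_filter.
  by case/andP=> /andP[/prime_gt0].
have Q_gt0 : (0 < Q)%N by rewrite !muln_gt0 m_gt0 fact_gt0.
have ZZQ : (8 * m * (Z`! * Z`!) %| Q)%N by rewrite /Q dvdn_mulr.
have ZQ : (Z`! %| Q)%N by apply: dvdn_trans ZZQ; rewrite dvdn_mull // dvdn_mull.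
have PQ : (8 * m * \prod_(p <- coprime_primes Z m) p %| Q)%N.
  by rewrite /Q [X in (_ %| X)%N]mulnAC dvdn_mulr.
have eulerE := admavg_euler d_gt0 d_even sf Z2 mZ Q_gt0 PQ.
rewrite (trunc_densityE d_even Q_gt0 yZ zZ ZZQ).
set E := admavg d Q _ in eulerE; set T := admavg d Q _.
have EL : `|E - L| <= eps.
  rewrite eulerE /L -/m -/A; set PP := \prod_(_ <= _ < _ | _) _.
  have -> : A * PP - Cconst d m * Aconst d g0 / (size (phiset d m))%:R
     = A * (PP - Cconst d m) by rewrite /A; ring.
  rewrite normrM; apply: (@le_trans _ _ ((`|A| + 1) * (eps / (`|A| + 1)))).
    by apply: ler_pM => //; [rewrite lerDl|apply: Z0P].
  by rewrite mulrCA divff ?mulr1 // lt0r_neq0.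
rewrite -(subrK E T) -addrA; apply: le_trans (ler_normD _ _) _.
apply: lerD => //; rewrite distrC /E /T -admavgB.
apply: le_trans (ler_norm_admavg _ _ _) _.
apply: (@le_trans _ _ (admavg d Q (fun n =>
    `|local_ratio R Z`! (n + 0) - trunc_ratio R y (n + 0)|
    + y%:R * `|local_ratio R Z`! (n + d) - trunc_ratio R z (n + d)|))).
  apply: admavg_le => // n; rewrite addn0.
  apply: ler_norm_mul_trunc; first exact: local_ratio_itv.
  exact: normr_trunc_ratio.
rewrite admavgD admavgZ; apply: lerD.
  by apply: admavg_trunc_error; rewrite // y_gt0.
by rewrite ler_wpM2l //; apply: admavg_trunc_error; rewrite // z_gt0.
Qed.

End DensityLimit.

(** * Sums over prime pairs *)

Section PrimePairSums.

Variable R : realType.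
Implicit Types (d q p k y z : nat) (x M E : R).

Lemma pi_set_uniq d x : uniq (pi_set d x).
Proof. by rewrite filter_uniq // iota_uniq. Qed.

Lemma sum_pi_residues d x q (h : nat -> R) : (0 < q)%N -> mod_periodic q h ->
  \sum_(p <- pi_set d x) h p = \sum_(0 <= a < q) h a * (pi_count d x a q)%:R.
Proof.
move=> q_gt0 hP; transitivity (\sum_(p <- pi_set d x) \sum_(0 <= a < q)
    h a * (p == a %[mod q])%N%:R).
  apply: eq_bigr => p _; rewrite (bigD1_seq (p %% q)%N) ?iota_uniq //=; last first.
    by rewrite mem_index_iota ltn_pmod.
  rewrite modn_mod eqxx mulr1 hP big_seq_cond big1 ?addr0 // => a.
  rewrite mem_index_iota => /andP[/andP[_ a_q] ap].
  by rewrite (modn_small a_q) eq_sym (negPf ap) mulr0.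
rewrite exchange_big /=; apply: eq_bigr => a _; rewrite -mulr_sumr; congr (_ * _).
rewrite /pi_count -sum1_count natr_sum [RHS]big_mkcond.
by apply: eq_bigr => p _; case: ifP.
Qed.

(** At most N + 1 members of [s] contribute. This absorbs the finitely many primes at which a
    periodic replacement fails. *)
Lemma sum_small_le (s : seq nat) N (f : nat -> R) : uniq s ->
  (forall p, `|f p| <= 1) -> {in s, forall p, (N < p)%N -> f p = 0} ->
  `|\sum_(p <- s) f p| <= N.+1%:R.
Proof.
move=> s_uniq f1 f0; apply: le_trans (ler_norm_sum _ _ _) _.
rewrite (bigID (fun p => p <= N)%N) /= [X in _ + X]big_seq_cond [X in _ + X]big1; last first.
  by move=> p /andP[ps]; rewrite -ltnNge => Np; rewrite f0 ?normr0.
rewrite addr0; apply: (@le_trans _ _ (\sum_(p <- s | (p <= N)%N) 1)).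
  exact: ler_sum.
rewrite [leLHS](_ : _ = (\sum_(p <- s | (p <= N)%N) 1)%N%:R); last by rewrite natr_sum.
rewrite sum1_count -size_filter ler_nat -[N.+1](size_iota 0).
apply: uniq_leq_size; first exact: filter_uniq.
by move=> p; rewrite mem_filter mem_iota add0n ltnS => /andP[].
Qed.

(* The q.+1 accounts for the p with p or p + d not coprime to q: one of these
   two primes then divides q, so p <= q. *)
Lemma sum_pi_periodic d x q M E (f : nat -> R) : ~~ odd d -> (0 < q)%N ->
  0 <= E -> mod_periodic q f -> (forall n, `|f n| <= 1) ->
  (forall a, (0 < a)%N -> adm d q a ->
     `|(pi_count d x a q)%:R - M / admcount R d q| <= E) ->
  `|\sum_(p <- pi_set d x) f p - admavg d q f * M| <= q%:R * E + q.+1%:R.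
Proof.
move=> d_even q_gt0 E_ge0 fP f1 countE.
have -> : \sum_(p <- pi_set d x) f p = \sum_(p <- pi_set d x) (adm d q p)%:R * f p
     + \sum_(p <- pi_set d x) (~~ adm d q p)%:R * f p.
  rewrite -big_split /=; apply: eq_bigr => p _.
  by case: adm; rewrite /= ?mul1r ?mul0r ?addr0 ?add0r.
rewrite addrAC; apply: le_trans (ler_normD _ _) _; apply: lerD.
  have hP : mod_periodic q (fun p => (adm d q p)%:R * f p).
    by apply: (periodic_map2 (fun (b : bool) (u : R) => b%:R * u)) => //; apply: adm_periodic.
  rewrite (sum_pi_residues _ _ q_gt0 hP) /admavg admsumE !mulr_suml -sumrB.
  apply: le_trans (ler_norm_sum _ _ _) _.
  apply: (@le_trans _ _ (\sum_(0 <= a < q) E)); last first.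
    by rewrite sumr_const_nat subn0 mulr_natl.
  apply: ler_sum => a _.
  have -> : (adm d q a)%:R * f a * (pi_count d x a q)%:R -
      (adm d q a)%:R * f a / admcount R d q * M
    = (adm d q a)%:R * (f a * ((pi_count d x a q)%:R - M / admcount R d q)) by ring.
  case: (boolP (adm d q a)) => adma; last by rewrite mul0r normr0.
  rewrite mul1r normrM; apply: (@le_trans _ _ (1 * E)); last by rewrite mul1r.
  apply: ler_pM => //.
  (* The residue a may be 0, whereas (H) concerns positive representatives, so a + q is used. *)
  have <- : pi_count d x (a + q) q = pi_count d x a q.
    by apply: eq_count => p; rewrite modnDr.
  by apply: countE; rewrite ?addn_gt0 ?q_gt0 ?orbT // -adm_periodic modnDr adm_periodic.
apply: sum_small_le; first exact: pi_set_uniq.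
  by move=> p; rewrite normrM normr_nat; case: adm; rewrite /= ?mul0r ?mul1r.
move=> p; rewrite mem_filter => /andP[/and5P[p_pr _ pd_pr _ _] _] qp.
suff -> : adm d q p by rewrite mul0r.
rewrite /adm !prime_coprime // !gtnNdvd //.
by rewrite (leq_trans qp) ?leq_addr.
Qed.

(** [Delta] and [Delta_per] can differ only at p <= |g|, which gives the constant term. The other
    two terms are the truncation errors, the second one multiplied by the bound y of the first
    truncated sum. *)
Lemma Pi_trunc_error d (g g0 gs : int) x y z : g != 0 -> g = g0 * gs ^+ 2 ->
  squarefree g0 -> 1 <= x -> (0 < y)%N -> (0 < z)%N ->
  `|Pi d g x - 4 * \sum_(p <- pi_set d x)
      (trunc_ratio R y p * trunc_ratio R z (p + d) * (Delta_per d g0 p)%:R)|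
  <= 4 * (`|g|%N.+1%:R + (x / y%:R + y%:R * (x / z%:R))).
Proof.
move=> g_neq0 gE sf x1 y_gt0 z_gt0.
have x0 : 0 <= x by apply: le_trans x1.
pose t n : R := totient_ratio R n.-1.
have t1 n : 0 <= t n <= 1.
  rewrite /t; have [n_gt1|n_le1] := ltnP 1 n.
    by rewrite -local_ratio_pred //; apply: local_ratio_itv.
  (* For n <= 1 the denominator is 0, and the ratio is 0 by convention. *)
  by rewrite /totient_ratio (_ : n.-1 = 0)%N ?invr0 ?mulr0 ?lexx ?ler01 //; lia.
have -> : Pi d g x = 4 * \sum_(p <- pi_set d x) t p * t (p + d)%N * (Delta d g p)%:R.
  by rewrite /Pi mulr_sumr; apply: eq_bigr => p _; rewrite /t /totient_ratio; ring.
rewrite -mulrBr normrM ger0_norm // ler_wpM2l //.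
rewrite -(subrK (\sum_(p <- pi_set d x) t p * t (p + d)%N * (Delta_per d g0 p)%:R)
            (\sum_(p <- pi_set d x) t p * t (p + d)%N * (Delta d g p)%:R)).
rewrite -addrA; apply: le_trans (ler_normD _ _) _; apply: lerD.
  rewrite -sumrB; apply: sum_small_le; first exact: pi_set_uniq.
    move=> p; rewrite -mulrBr normrM; have /andP[a0 a1] := t1 p.
    have /andP[b0 b1] := t1 (p + d)%N.
    apply: mulr_ile1; rewrite ?normr_ge0 //.
      by rewrite ger0_norm ?mulr_ge0 // mulr_ile1.
    by rewrite /Delta; case: (_ && _); case: Delta_per; rewrite /= ?subrr ?subr0 ?sub0r ?normrN ?normr1 ?normr0.
  move=> p; rewrite mem_filter => /andP[/and5P[p_pr p_odd pd_pr pd_odd _] _] gp.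
  rewrite (Delta_prime gE) ?subrr //.
    by rewrite dvdzE gtnNdvd // absz_gt0.
  by rewrite dvdzE gtnNdvd ?absz_gt0 // (leq_trans gp) // leq_addr.
rewrite -sumrB.
have tr : (Num.truncn x)%:R <= x by rewrite truncn_le.
have mem_pi p : p \in pi_set d x -> (1 < p <= Num.truncn x)%N && (1 < p + d <= Num.truncn x)%N.
  rewrite mem_filter => /andP[/and5P[p_pr _ pd_pr _ /andP[px pdx]] _].
  by rewrite !prime_gt1 // !truncn_ge_nat // px pdx.
apply: (@le_trans _ _ (\sum_(p <- pi_set d x) `|t p - trunc_ratio R y p|
   + y%:R * \sum_(p <- pi_set d x) `|t (p + d)%N - trunc_ratio R z (p + d)|)).
  apply: le_trans (ler_norm_sum _ _ _) _; rewrite mulr_sumr -big_split /=.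
  apply: ler_sum => p _; apply: ler_norm_mul_trunc; first exact: t1.
  exact: normr_trunc_ratio.
apply: lerD.
  apply: le_trans (sum_totient_error R (N := Num.truncn x) y_gt0 (pi_set_uniq d x) _) _ => [p|].
    by move/mem_pi/andP => [].
  by rewrite ler_wpM2r ?invr_ge0.
rewrite ler_wpM2l // -(big_map (addn^~ d) xpredT (fun n => `|t n - trunc_ratio R z n|)).
apply: le_trans (sum_totient_error R (N := Num.truncn x) z_gt0 _ _) _.
- by rewrite map_inj_uniq ?pi_set_uniq //; apply: addIn.
- by move=> n /mapP[p /mem_pi/andP[_ ?] ->].
by rewrite ler_wpM2r ?invr_ge0.
Qed.

(** There are y z pairs (k1, k2), each with weight at most 1, and a modulus q costs q E + q + 1 <= q
    (E + 2) with q at most 8 * gtilde * y z. *)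
Lemma trunc_sum_error d (g0 : int) x y z M E : ~~ odd d -> squarefree g0 ->
  0 <= E ->
  (forall a q, (0 < a)%N -> (0 < q)%N -> (q <= 8 * gtilde g0 * (y * z))%N ->
     adm d q a -> `|(pi_count d x a q)%:R - M / admcount R d q| <= E) ->
  `|\sum_(p <- pi_set d x)
      (trunc_ratio R y p * trunc_ratio R z (p + d) * (Delta_per d g0 p)%:R)
    - trunc_density R d g0 y z * M|
  <= (8 * gtilde g0)%:R * (y * z)%:R ^+ 2 * (E + 2).
Proof.
move=> d_even sf E_ge0 countE; set D := (8 * gtilde g0)%N.
have D_gt0 : (0 < D)%N by have := odd_gtilde sf; rewrite /D; case: gtilde.
pose F k1 k2 n : R := (n == 1 %[mod k1])%N%:R * (n + d == 1 %[mod k2])%N%:R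
   * (Delta_per d g0 n)%:R.
have -> : \sum_(p <- pi_set d x)
      (trunc_ratio R y p * trunc_ratio R z (p + d) * (Delta_per d g0 p)%:R)
  = \sum_(1 <= k1 < y.+1) mobius_over R k1 * \sum_(1 <= k2 < z.+1) mobius_over R k2 *
      \sum_(p <- pi_set d x) F k1 k2 p.
  under [RHS]eq_bigr do under eq_bigr do rewrite mulr_sumr.
  under [RHS]eq_bigr do rewrite exchange_big mulr_sumr.
  rewrite exchange_big; apply: eq_bigr => p _.
  rewrite /trunc_ratio -mulrA mulr_suml; apply: eq_bigr => k1 _.
  rewrite -!mulrA; congr (_ * _); rewrite mulr_suml mulr_sumr.
  by apply: eq_bigr => k2 _; rewrite /F; ring.
rewrite /trunc_density mulr_suml -sumrB.
apply: le_trans (ler_norm_sum _ _ _) _.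
pose B : R := D%:R * (y * z)%:R * (E + 2).
have termB k1 k2 : (0 < k1 <= y)%N -> (0 < k2 <= z)%N ->
    `|\sum_(p <- pi_set d x) F k1 k2 p - admavg d (D * (k1 * k2)) (F k1 k2) * M| <= B.
  move=> /andP[k1_gt0 k1y] /andP[k2_gt0 k2z].
  have q_gt0 : (0 < D * (k1 * k2))%N by rewrite muln_gt0 D_gt0 muln_gt0 k1_gt0.
  have q_le : (D * (k1 * k2) <= D * (y * z))%N by rewrite leq_mul2l leq_mul ?orbT.
  apply: le_trans (@sum_pi_periodic d x _ M E (F k1 k2) d_even q_gt0 E_ge0 _ _ _) _.
  - exact: trunc_term_periodic.
  - move=> n; rewrite /F -!natrM normr_nat lern1.
    by do 2!case: (_ == _); case: Delta_per.
  - by move=> a a_gt0; apply: countE.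
  have q1 : 1 <= (D * (k1 * k2))%:R :> R by rewrite ler1n.
  have q2 : (D * (k1 * k2))%:R <= D%:R * (y * z)%:R :> R by rewrite -natrM ler_nat.
  rewrite -natr1 /B; nra.
apply: (@le_trans _ _ (\sum_(1 <= k1 < y.+1) \sum_(1 <= k2 < z.+1) B)); last first.
  rewrite !sumr_const_nat !subn1 /= /B -mulrnA -[leLHS]mulr_natl [(z * y)%N]mulnC.
  move: (D%:R : R) ((y * z)%:R : R) => u v.
  by rewrite [leLHS](_ : _ = u * v ^+ 2 * (E + 2)) //; ring.
rewrite big_seq [leRHS]big_seq; apply: ler_sum => k1; rewrite mem_index_iota ltnS => k1y.
rewrite -mulrA -mulrBr normrM mulr_suml -sumrB.
apply: (@le_trans _ _ (1 * \sum_(1 <= k2 < z.+1) B)); last by rewrite mul1r.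
apply: ler_pM => //; first by rewrite mobius_over_le1 //; case/andP: k1y.
apply: le_trans (ler_norm_sum _ _ _) _.
rewrite big_seq [leRHS]big_seq; apply: ler_sum => k2; rewrite mem_index_iota ltnS => k2z.
rewrite -mulrA -mulrBr normrM; apply: (@le_trans _ _ (1 * B)); last by rewrite mul1r.
apply: ler_pM => //; first by rewrite mobius_over_le1 //; case/andP: k2z.
exact: termB.
Qed.

(** Here z = y^4. Then y x/z <= x/y, y/sqrt z = 1/y <= 1/sqrt y, the moduli reach 8 * gtilde * y^5,
    and (y z)^2 = y^10. *)
Lemma Pi_error d (g g0 gs : int) x y M E : (0 < d)%N -> ~~ odd d ->
  g != 0 -> g = g0 * gs ^+ 2 -> squarefree g0 -> 1 <= x -> (0 < y)%N -> 0 <= E ->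
  (forall a q, (0 < a)%N -> (0 < q)%N -> (q <= 8 * gtilde g0 * y ^ 5)%N ->
     adm d q a -> `|(pi_count d x a q)%:R - M / admcount R d q| <= E) ->
  `|Pi d g x - 4 * (Cconst d (gtilde g0) * Aconst d g0
              / (size (phiset d (gtilde g0)))%:R) * M|
  <= 4 * (`|g|%N.+1%:R + 2 * (x / y%:R)
          + (8 * gtilde g0)%:R * y%:R ^+ 10 * (E + 2)
          + 4 * Num.sqrt 6 / Num.sqrt y%:R * `|M|).
Proof.
move=> d_gt0 d_even g_neq0 gE sf x1 y_gt0 E_ge0 countE.
set L : R := _ / _.
have y1 : 1 <= y%:R :> R by rewrite ler1n.
have y0 : 0 < y%:R :> R by rewrite ltr0n.
have z_gt0 : (0 < y ^ 4)%N by rewrite expn_gt0 y_gt0.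
have h1 := Pi_trunc_error d g_neq0 gE sf x1 y_gt0 z_gt0.
have h2 := @trunc_sum_error d g0 x y (y ^ 4) M E d_even sf E_ge0.
rewrite -expnS in h2; have {}h2 := h2 countE.
have h3 := trunc_density_error R d_gt0 d_even sf y_gt0 z_gt0.
rewrite -/L in h3.
set S := \sum_(p <- _) _ in h1 h2; set T := trunc_density _ _ _ _ _ in h2 h3.
have -> : Pi d g x - 4 * L * M = (Pi d g x - 4 * S) + 4 * (S - T * M) + 4 * ((T - L) * M).
  by ring.
apply: le_trans (ler_normD _ _) _.
rewrite [leRHS](_ : _ = 4 * (`|g|%N.+1%:R + 2 * (x / y%:R))
   + 4 * ((8 * gtilde g0)%:R * y%:R ^+ 10 * (E + 2))
   + 4 * (4 * Num.sqrt 6 / Num.sqrt y%:R * `|M|)); last by ring.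
apply: lerD.
  apply: le_trans (ler_normD _ _) _; apply: lerD.
    apply: le_trans h1 _; rewrite ler_wpM2l // lerD2l [2 * _]mulr_natl mulr2n lerD2l.
    rewrite natrX mulrCA ler_wpM2l ?(le_trans ler01) //.
    rewrite exprS invfM mulVKf ?lt0r_neq0 // lef_pV2 ?posrE ?exprn_gt0 //.
    by rewrite exprS ler_peMr ?(ltW y0) // exprn_ege1.
  rewrite normrM ger0_norm // ler_wpM2l //; apply: le_trans h2 _.
  by rewrite natrX -exprM.
rewrite !normrM ger0_norm // ler_wpM2l // ler_wpM2r //; apply: le_trans h3 _.
have sy : 0 < Num.sqrt y%:R :> R by rewrite sqrtr_gt0.
rewrite natrX (_ : 4%N = (2 * 2)%N) // exprM sqrtr_sqr ger0_norm; last first.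
  by rewrite exprn_ge0 ?(ltW y0).
rewrite [leRHS](_ : _ = 2 * Num.sqrt 6 / Num.sqrt y%:R + 2 * Num.sqrt 6 * (Num.sqrt y%:R)^-1);
  last by ring.
rewrite lerD2l mulrCA ler_wpM2l ?mulr_ge0 ?sqrtr_ge0 //.
rewrite expr2 invfM mulVKf ?lt0r_neq0 // lef_pV2 ?posrE //.
rewrite -{2}(@sqr_sqrtr _ (y%:R : R)) ?(ltW y0) // expr2 ler_peMr ?(ltW sy) //.
by rewrite -[leLHS]sqrtr1 ler_wsqrtr.
Qed.

End PrimePairSums.

(** * The cut-off as a power of log x *)

Lemma ln_pow_le (R : realType) (n : nat) (x : R) : 1 <= x ->
  ln x ^+ n <= n`!%:R * x.
Proof.
move=> x1; have x0 : 0 < x by apply: lt_le_trans x1.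
case: n => [|n]; first by rewrite expr0 fact0 mul1r.
have := expR_ge1Dxn n (ln_ge0 x1); rewrite lnK // => h.
rewrite mulrC -ler_pdivrMr ?ltr0n ?fact_gt0 //; apply: le_trans h.
by rewrite lerDr.
Qed.

Lemma pi_count_le (R : realType) (d a q : nat) (x : R) : 1 <= x ->
  (pi_count d x a q)%:R <= 2 * x.
Proof.
move=> x1; apply: (@le_trans _ _ (Num.truncn x).+1%:R).
  rewrite ler_nat; apply: leq_trans (count_size _ _) _.
  by rewrite size_filter; apply: leq_trans (count_size _ _) _; rewrite size_iota.
have : (Num.truncn x)%:R <= x by rewrite truncn_le (le_trans ler01).
by rewrite -natr1; lra.
Qed.


(** The content of (H) at a single [x] with the constant already chosen; it keeps the passage to
    large x out of the main estimate. *)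
Definition pair_count_bound (R : realType) (d : nat) (B' C' K x : R) :=
  forall a q : nat, (0 < a)%N -> (0 < q)%N ->
    q%:R <= ln x `^ B' -> coprime a q -> coprime (a + d) q ->
    `| (pi_count d x a q)%:R
       - 2 / (size (phiset d q))%:R * local_factor d * C2 * Li2 x |
    <= K * (x / ln x `^ C').

(** With l = ln x and y close to l^e, the choice e = 2m makes 1/sqrt y of order l^(-m). The moduli
    are at most D y^5 <= l^(5e+1) because D <= l, and the saving l^(10e+m) in (H) outweighs the
    factor y^10 and still leaves x/l^m. *)
Lemma Pi_error_log (R : realType) (d : nat) (g g0 gs : int) (C K0 K1 x : R) (m : nat)
    (e := (2 * m)%N) (D := (8 * gtilde g0)%N) :
  (0 < d)%N -> ~~ odd d -> g != 0 -> g = g0 * gs ^+ 2 -> squarefree g0 ->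
  0 < C -> C <= m%:R -> 1 <= x -> D%:R + 1 <= ln x ->
  pair_count_bound d 0 0 K0 x ->
  pair_count_bound d (5 * e + 1)%:R (10 * e + m)%:R K1 x ->
  `| Pi d g x
     - 8 * (Cconst d (gtilde g0) * Aconst d g0
            / (size (phiset d (gtilde g0)))%:R)
         * local_factor d * C2 * Li2 x |
  <= 4 * (`|g|%N.+1%:R * m`!%:R + 8 + D%:R * `|K1|
   + 2 * D%:R * (10 * e + m)`!%:R + 8 * Num.sqrt 6 * (2 + `|K0|)) * (x / ln x `^ C).
Proof.
move=> d_gt0 d_even g_neq0 g_decomp g0_sqfree C_gt0 C_m x1 lD K0P K1P.
have x0 : 0 < x by apply: lt_le_trans x1.
rewrite /pair_count_bound in K0P K1P.
set l := ln x in lD K0P K1P *; pose M : R := 2 * local_factor d * C2 * Li2 x.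
have l1 : 1 <= l by apply: le_trans lD; rewrite lerDr.
have l0 : 0 < l by apply: lt_le_trans l1.
have lD' : D%:R <= l by apply: le_trans lD; rewrite lerDl.
have ln0 n : 0 < l ^+ n by apply: exprn_gt0.
(* (H) with q = 1 bounds the main term by O(x), so Li2 need not be estimated. *)
have M_le : `|M| <= (2 + `|K0|) * x.
  have := K0P 1%N 1%N isT isT; rewrite powRr0 invr1 mulr1 !coprimen1 => /(_ (lexx _) isT isT).
  rewrite size_phiset admcount1 invr1 mulr1 -/M => h1.
  have c2 := pi_count_le d 1 1 x1.
  have K0x : K0 * x <= `|K0| * x by rewrite ler_wpM2r ?ler_norm // ltW.
  rewrite -(subrK (pi_count d x 1 1)%:R M); apply: le_trans (ler_normD _ _) _.
  rewrite distrC normr_nat; lra.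
pose y := Num.truncn (l ^+ e).
have le1 : 1 <= l ^+ e by apply: exprn_ege1.
have y_gt0 : (0 < y)%N by rewrite truncn_gt0.
have /andP[y_le y_gt] := truncn_itv (ltW (ln0 e)); rewrite -/y in y_le y_gt.
have y1 : 1 <= y%:R :> R by rewrite ler1n.
pose E := `|K1| * (x / l ^+ (10 * e + m)).
have E_ge0 : 0 <= E by rewrite mulr_ge0 // divr_ge0 ?ltW.
have countE a q : (0 < a)%N -> (0 < q)%N -> (q <= D * y ^ 5)%N -> adm d q a ->
    `|(pi_count d x a q)%:R - M / admcount R d q| <= E.
  move=> a_gt0 q_gt0 q_le /andP[aq adq].
  have -> : M / admcount R d q
     = 2 / (size (phiset d q))%:R * local_factor d * C2 * Li2 x.
    by rewrite size_phiset /M; ring.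
  apply: le_trans (K1P a q a_gt0 q_gt0 _ aq adq) _.
    rewrite powR_mulrn ?(ltW l0) //.
    apply: (@le_trans _ _ (D * y ^ 5)%:R); first by rewrite ler_nat.
    rewrite natrM natrX addn1 [leRHS]exprS ler_pM // ?exprn_ge0 //.
    by rewrite mulnC exprM lerXn2r // ?nnegrE // ltW.
  rewrite powR_mulrn ?(ltW l0) // ler_wpM2r ?ler_norm //.
  by rewrite divr_ge0 ?ltW.
have main := Pi_error d_gt0 d_even g_neq0 g_decomp g0_sqfree x1 y_gt0 E_ge0 countE.
have -> : Pi d g x - 8 * (Cconst d (gtilde g0) * Aconst d g0
              / (size (phiset d (gtilde g0)))%:R) * local_factor d * C2 * Li2 x
  = Pi d g x - 4 * (Cconst d (gtilde g0) * Aconst d g0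
              / (size (phiset d (gtilde g0)))%:R) * M.
  by rewrite /M; ring.
apply: le_trans main _; rewrite -/D.
pose X := x / l ^+ m.
have X_ge0 : 0 <= X by rewrite divr_ge0 ?ltW.
have X_le : X <= x / l `^ C.
  rewrite /X ler_wpM2l ?(ltW x0) // lef_pV2 ?posrE ?powR_gt0 //.
  by rewrite -powR_mulrn ?(ltW l0) // ler_powR.
set Kc := (X in _ <= X * (x / _)); apply: (@le_trans _ _ (Kc * X)); last first.
  by rewrite ler_wpM2l // /Kc; rewrite mulr_ge0 // !addr_ge0 // ?mulr_ge0 ?sqrtr_ge0 ?addr_ge0.
have distr (a b c u v : R) : (a + b + c + u + v) * X = a * X + b * X + (c + u) * X + v * X.
  by ring.
rewrite /Kc -[leRHS]mulrA ler_wpM2l // distr.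
(* y is within a factor 2 of (ln x)^(2m), hence 1/sqrt y <= 2/(ln x)^m *)
have lm : 0 < l ^+ m / 2 by rewrite divr_gt0.
have lm_le : l ^+ m / 2 <= Num.sqrt y%:R.
  rewrite -(ger0_norm (ltW lm)) -sqrtr_sqr; apply: ler_wsqrtr.
  rewrite expr_div_n -exprM mulnC -/e.
  by move: y_gt; rewrite -natr1; lra.
have sq : (Num.sqrt y%:R)^-1 <= 2 / l ^+ m.
  by rewrite -[leRHS]invf_div lef_pV2 ?posrE // (lt_le_trans lm).
have iy : (y%:R)^-1 <= 2 / l ^+ m.
  apply: le_trans sq; rewrite lef_pV2 ?posrE ?sqrtr_gt0 ?ltr0n //.
  rewrite -{2}(@sqr_sqrtr _ (y%:R : R)) // expr2 ler_peMr ?sqrtr_ge0 //.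
  by rewrite -[leLHS]sqrtr1 ler_wsqrtr.
(* Terms free of x, and pure powers of ln x, are absorbed in x/l^m; this is where the factorials in
   the constant come from. *)
have pow_le n : l ^+ n <= (n + m)`!%:R * X.
  by rewrite /X mulrA ler_pdivlMr // -exprD ln_pow_le.
apply: lerD; first apply: lerD; first apply: lerD.
- by rewrite -mulrA ler_peMr // -(expr0 l) (le_trans (pow_le 0%N)).
- rewrite [leRHS](_ : _ = 2 * (x * (4 / l ^+ m))); last by rewrite /X; ring.
  rewrite ler_wpM2l // ler_wpM2l ?(ltW x0) //; apply: le_trans iy _.
  by rewrite ler_wpM2r ?invr_ge0 ?ltW // ; lra.
- have y10 : y%:R ^+ 10 <= l ^+ (10 * e).
    by rewrite mulnC exprM lerXn2r // ?nnegrE // ltW.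
  have EX : l ^+ (10 * e) * E = `|K1| * X.
    by rewrite /E /X exprD; field; rewrite !expf_neq0 ?lt0r_neq0.
  move: (D%:R : R) (ler0n R D) => u u0.
  apply: (@le_trans _ _ (u * (l ^+ (10 * e) * (E + 2)))).
    by rewrite -mulrA ler_wpM2l // ler_wpM2r // addr_ge0.
  have -> : l ^+ (10 * e) * (E + 2) = `|K1| * X + 2 * l ^+ (10 * e) by rewrite -EX; ring.
  have := pow_le (10 * e)%N; move: (l ^+ _) (_`!%:R : R) => v w vw.
  rewrite -subr_ge0 [X in 0 <= X](_ : _ = 2 * u * (w * X - v)); last by ring.
  by rewrite !mulr_ge0 // subr_ge0.
rewrite [leRHS](_ : _ = 4 * Num.sqrt 6 * (2 / l ^+ m) * ((2 + `|K0|) * x)); last first.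
  by rewrite /X; ring.
apply: ler_pM => //.
by rewrite ler_wpM2l // mulr_ge0 ?sqrtr_ge0.
Qed.

Theorem theorem2 (R : realType) (d : nat) (g g0 gs : int)
  (d_gt0 : (0 < d)%N) (d_even : ~~ odd d)
  (g_neqN1 : g <> -1)
  (g_not_power : forall (b : int) (h : nat), (2 <= h)%N -> g <> b ^+ h)
  (g_decomp : g = g0 * gs ^+ 2) (g0_sqfree : squarefree g0)
  (admissible : artin_admissible d g)
  (H : hypothesis_H R d) :
  forall C : R, 0 < C ->
  exists K : R, \forall x \near +oo,
    `| Pi d g x
       - 8 * (Cconst d (gtilde g0) * Aconst d g0
              / (size (phiset d (gtilde g0)))%:R)
           * local_factor d * C2 * Li2 x |
    <= K * (x / ln x `^ C).
Proof.
move=> C C_gt0.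
have g_neq0 : g != 0.
  by apply/eqP => g_0; apply: (g_not_power 0 2%N) => //; rewrite expr0n.
set m := (Num.truncn C).+1.
have C_m : C <= m%:R by have /andP[_ /ltW] := truncn_itv (ltW C_gt0).
have [K0 K0P] := H 0 0 (lexx _) (lexx _).
have [K1 K1P] := H (5 * (2 * m) + 1)%:R (10 * (2 * m) + m)%:R (ler0n _ _) (ler0n _ _).
eexists; near=> x.
have x1 : 1 <= x by near: x; apply: nbhs_pinfty_ge; rewrite num_real.
(* For such x one extra power of ln x pays for the factor 8 * gtilde in the moduli, and ln x >=
   1. *)
have lD : (8 * gtilde g0)%:R + 1 <= ln x.
  have xD : expR ((8 * gtilde g0)%:R + 1) <= x.
    by near: x; apply: nbhs_pinfty_ge; rewrite num_real.
  by rewrite -[leLHS]expRK ler_ln ?posrE ?expR_gt0 // (lt_le_trans ltr01 x1).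
apply: (Pi_error_log (K0 := K0) (K1 := K1) d_gt0 d_even g_neq0 g_decomp g0_sqfree
          C_gt0 C_m x1 lD).
- by near: x; exact: K0P.
- by near: x; exact: K1P.
Unshelve. all: by end_near.
Qed.
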